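(* Assume the Combinatorial 4-Clique hypothesis. Then any combinatorial algorithm computing incremental {\rm stBP}, and likewise decremental {\rm stBP}, on $n$-node directed graphs requires $n^{4-o(1)}$ total update and query time.
   Context: {\rm stBP}: for a directed edge-weighted graph and fixed nodes $s,t$, maintain $\mathbf{b}(s,t)$, the maximum over $s$–$t$ paths of the minimum edge weight on the path. Incremental: only edge insertions; decremental: only edge deletions. ''Combinatorial'' refers to algorithms not using fast-matrix-multiplication-type algebraic techniques. Combinatorial 4-Clique hypothesis: for no $\varepsilon>0$ is there an $O(n^{4-\varepsilon})$ combinatorial algorithm deciding whether an $n$-node graph contains a 4-clique. *)

(* Defs.v *)
Set Warnings "-notation-overridden".
From Stdlib Require Import Reals.
From mathcomp Require Import all_boot.

Set Implicit Arguments.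
Unset Strict Implicit.
Unset Printing Implicit Defensive.

(* MathComp takes over the usual key %R. *)
Delimit Scope R_scope with coqR.

(* Word RAM with finitely many named registers and zero-initialised arrays.
   Words have O(log n) bits: a run is legal only if every value written to a
   register is below the bound B, which is (n + 2) ^ c for a constant c. *)

Record store := Store { reg : nat -> nat; arr : nat -> nat -> nat }.

Definition set_reg (s : store) (x v : nat) : store :=
  Store (fun y => if y == x then v else reg s y) (arr s).

Definition set_arr (s : store) (a i v : nat) : store :=
  Store (reg s)
        (fun b j => if (b == a) && (j == i) then v else arr s b j).

Inductive binop : Set :=
  | Add | Sub | Mul | Div | Mod | And | Or | Xor | Shl | Shr | Eq | Lt.

Definition eval_binop (o : binop) (m n : nat) : nat :=
  match o with
  | Add => m + n
  | Sub => m - n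
  | Mul => m * n
  | Div => m %/ n
  | Mod => m %% n
  | And => Nat.land m n
  | Or => Nat.lor m n
  | Xor => Nat.lxor m n
  | Shl => m * 2 ^ n
  | Shr => m %/ 2 ^ n
  | Eq => m == n
  | Lt => m < n
  end.

(* Names: x, y, z are registers, a is an array.  [CLib c] behaves as c; it
   marks c as library code, whose running time is accounted for separately. *)
Inductive cmd : Set :=
  | CSkip
  | CConst (x v : nat)
  | COp (o : binop) (x y z : nat)
  | CLoad (x a y : nat)
  | CStore (a x y : nat)
  | CSeq (c d : cmd)
  | CIf (x : nat) (c d : cmd)
  | CWhile (x : nat) (c : cmd)
  | CLib (c : cmd).

(* [exec B c s own lib s']: with words below B, c started in s halts in s'
   after own unit-cost steps of its own and lib steps inside library code. *)
Inductive exec (B : nat) : cmd -> store -> nat -> nat -> store -> Prop :=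
  | ExSkip s : exec B CSkip s 0 0 s
  | ExConst s x v :
      v < B -> exec B (CConst x v) s 1 0 (set_reg s x v)
  | ExOp s o x y z :
      eval_binop o (reg s y) (reg s z) < B ->
      exec B (COp o x y z) s 1 0
           (set_reg s x (eval_binop o (reg s y) (reg s z)))
  | ExLoad s x a y :
      arr s a (reg s y) < B ->
      exec B (CLoad x a y) s 1 0 (set_reg s x (arr s a (reg s y)))
  | ExStore s a x y :
      exec B (CStore a x y) s 1 0 (set_arr s a (reg s x) (reg s y))
  | ExSeq c d s s' s'' own lib own' lib' :
      exec B c s own lib s' -> exec B d s' own' lib' s'' ->
      exec B (CSeq c d) s (own + own') (lib + lib') s''
  | ExIfT x c d s s' own lib :
      reg s x != 0 -> exec B c s own lib s' ->
      exec B (CIf x c d) s own.+1 lib s'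
  | ExIfF x c d s s' own lib :
      reg s x = 0 -> exec B d s own lib s' ->
      exec B (CIf x c d) s own.+1 lib s'
  | ExWhileT x c s s' s'' own lib own' lib' :
      reg s x != 0 -> exec B c s own lib s' ->
      exec B (CWhile x c) s' own' lib' s'' ->
      exec B (CWhile x c) s (own + own').+1 (lib + lib') s''
  | ExWhileF x c s :
      reg s x = 0 -> exec B (CWhile x c) s 1 0 s
  | ExLib c s s' own lib :
      exec B c s own lib s' -> exec B (CLib c) s 1 (own + lib) s'.

Definition word_bound (n c : nat) : nat := (n + 2) ^ c.

(* t <= D * n ^ p with a real exponent p *)
Definition time_bound (D p : R) (n t : nat) : Prop :=
  (INR t <= D * Rpower (INR n) p)%coqR.

(* n x n matrices are stored row by row. *)
Definition matrix_word (n : nat) (M : 'I_n -> 'I_n -> nat) (i : nat) : nat :=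
  if insub (i %/ n) is Some u then
    if insub (i %% n) is Some v then M u v else 0
  else 0.

Definition matrix_array (n : nat) (M : 'I_n -> 'I_n -> nat)
    (a i : nat) : nat :=
  if a == 0 then matrix_word M i else 0.

Definition set_args (s : store) (x y z : nat) : store :=
  set_reg (set_reg (set_reg s 0 x) 1 y) 2 z.

Definition zero_regs : nat -> nat := fun=> 0.

(* 4-Clique.  A simple graph is a symmetric irreflexive relation.  Input: n in
   register 0, the adjacency matrix in array 0; the answer is in register 0. *)

Definition has_clique4 (T : finType) (e : rel T) : Prop :=
  exists Q : {set T},
    #|Q| = 4 /\ {in Q &, forall x y, x != y -> e x y}.

Definition clique_input (n : nat) (e : rel 'I_n) : store :=
  set_reg (Store zero_regs (matrix_array (fun u v => nat_of_bool (e u v)))) 0 n.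

Definition decides_clique4 (P : cmd) (p : R) : Prop :=
  exists (c : nat) (D : R), forall (n : nat) (e : rel 'I_n),
    0 < n -> symmetric e -> irreflexive e ->
    exists (own lib : nat) (s : store),
      [/\ exec (word_bound n c) P (clique_input e) own lib s,
          reg s 0 <> 0 <-> has_clique4 e
        & time_bound D p n (own + lib)].

(* Edge-weighted directed graphs on 'I_n.  Weights are positive and the entry
   0 means that the arc is absent. *)

Definition wdigraph (n : nat) := 'I_n -> 'I_n -> nat.

Definition arc (n : nat) (G : wdigraph n) : rel 'I_n :=
  fun u v => G u v != 0.

(* p lists the vertices of the path that follow s. *)
Definition st_path (n : nat) (G : wdigraph n) (s t : 'I_n)
    (p : seq 'I_n) : bool :=
  [&& path (arc G) s p, last s p == t & uniq (s :: p)].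

Definition path_width (n : nat) (G : wdigraph n) (s : 'I_n)
    (p : seq 'I_n) : nat :=
  foldr minn (G s (head s p)) (pairmap G s p).

(* b = b(s,t) for s != t, with the value 0 (below every weight) when there is
   no s-t path. *)
Definition is_bottleneck (n : nat) (G : wdigraph n) (s t : 'I_n)
    (b : nat) : Prop :=
  (forall p, st_path G s t p -> path_width G s p <= b) /\
  ((exists2 p, st_path G s t p & path_width G s p = b) \/
   ((forall p, ~~ st_path G s t p) /\ b = 0)).

Definition update (n : nat) : Type := ('I_n * 'I_n * nat)%type.

(* A deletion of (u, v) is represented by the update (u, v, 0). *)
Definition apply_update (n : nat) (G : wdigraph n) (q : update n) :
    wdigraph n :=
  fun x y => if (x == q.1.1) && (y == q.1.2) then q.2 else G x y.

Inductive setting : Set := Incremental | Decremental.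

(* W bounds the edge weights.  Incremental sequences start from the graph
   without edges, decremental ones from an arbitrary simple digraph. *)
Definition valid_start (k : setting) (W n : nat) (G : wdigraph n) : Prop :=
  match k with
  | Incremental => forall u v, G u v = 0
  | Decremental => forall u v, G u v <= W /\ (u = v -> G u v = 0)
  end.

Definition valid_update (k : setting) (W n : nat) (G : wdigraph n)
    (q : update n) : bool :=
  match k with
  | Incremental => [&& q.1.1 != q.1.2, ~~ arc G q.1.1 q.1.2 & 0 < q.2 <= W]
  | Decremental => arc G q.1.1 q.1.2 && (q.2 == 0)
  end.

Fixpoint valid_updates (k : setting) (W n : nat) (G : wdigraph n)
    (us : seq (update n)) : bool :=
  if us is q :: us' then
    valid_update k W G q && valid_updates k W (apply_update G q) us'
  else true.

(* A dynamic algorithm consists of three procedures acting on a common store.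
   Arguments are passed in registers 0, 1, 2; a query answers in register 0. *)
Record dyn_alg := DynAlg { do_init : cmd; do_update : cmd; do_query : cmd }.

Definition dyn_input (n : nat) (G : wdigraph n) (s t : 'I_n) : store :=
  set_args (Store zero_regs (matrix_array G)) n s t.

(* [serves B A s t G m us T]: from the store m, which A holds for the current
   graph G, algorithm A processes us one update at a time, reports the correct
   b(s,t) after each of them, and spends T steps altogether. *)
Inductive serves (B : nat) (A : dyn_alg) (n : nat) (s t : 'I_n) :
    wdigraph n -> store -> seq (update n) -> nat -> Prop :=
  | ServesNil (G : wdigraph n) m : serves B A s t G m [::] 0
  | ServesCons (G : wdigraph n) m (q : update n) us m1 m2
      own1 lib1 own2 lib2 T :
      exec B (do_update A) (set_args m q.1.1 q.1.2 q.2) own1 lib1 m1 ->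
      exec B (do_query A) m1 own2 lib2 m2 ->
      is_bottleneck (apply_update G q) s t (reg m2 0) ->
      serves B A s t (apply_update G q) m2 us T ->
      serves B A s t G m (q :: us) (own1 + lib1 + (own2 + lib2) + T).

(* Weights are O(log n)-bit integers, i.e. at most n ^ k for a constant k.
   The total time includes the initialisation. *)
Definition solves_stBP (K : setting) (A : dyn_alg) (p : R) : Prop :=
  forall k : nat, exists (c : nat) (D : R),
  forall (n : nat) (s t : 'I_n) (G : wdigraph n) (us : seq (update n)),
    s != t -> valid_start K (n ^ k) G -> valid_updates K (n ^ k) G us ->
    exists (own lib : nat) (m : store) (T : nat),
      [/\ exec (word_bound n c) (do_init A) (dyn_input G s t) own lib m,
          serves (word_bound n c) A s t G m us T
        & time_bound D p n (own + lib + T)].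

(* "Combinatorial" has no formal definition; it is represented by an arbitrary
   class of static and dynamic algorithms, of which only closure under
   linear-time reductions is assumed. *)

Record algorithm_class := AlgorithmClass {
  static_alg : cmd -> Prop;
  dynamic_alg : dyn_alg -> Prop
}.

Fixpoint rename (f : nat -> nat) (c : cmd) : cmd :=
  match c with
  | CSkip => CSkip
  | CConst x v => CConst (f x) v
  | COp o x y z => COp o (f x) (f y) (f z)
  | CLoad x a y => CLoad (f x) (f a) (f y)
  | CStore a x y => CStore (f a) (f x) (f y)
  | CSeq c d => CSeq (rename f c) (rename f d)
  | CIf x c d => CIf (f x) (rename f c) (rename f d)
  | CWhile x c => CWhile (f x) (rename f c)
  | CLib c => CLib (rename f c)
  end.

(* As a subroutine, A runs on the odd-numbered registers and arrays, so that
   the calling program can keep the even-numbered ones to itself. *)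
Definition procedure_of (A : dyn_alg) (c : cmd) : Prop :=
  let odd_names := rename (fun x => x.*2.+1) in
  [\/ c = odd_names (do_init A), c = odd_names (do_update A)
    | c = odd_names (do_query A)].

Fixpoint library_in (L : cmd -> Prop) (c : cmd) : Prop :=
  match c with
  | CSeq c d | CIf _ c d => library_in L c /\ library_in L d
  | CWhile _ c => library_in L c
  | CLib c => L c
  | _ => True
  end.

(* On n-node graphs (n ^ 2 input words) P makes O(n ^ 2) steps, not counting
   the steps made inside library code. *)
Definition linear_own_time (P : cmd) : Prop :=
  exists K : nat, forall (B n : nat) (e : rel 'I_n) (own lib : nat) (s : store),
    exec B P (clique_input e) own lib s -> own <= K * (n ^ 2 + 1).

(* If P makes linearly many steps of its own and otherwise only calls the
   procedures of an algorithm of the class, then P is in the class.  A linear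
   number of own steps leaves no room for fast matrix multiplication; without
   this restriction every program would be in the class. *)
Definition closed_under_linear_reductions (C : algorithm_class) : Prop :=
  forall (A : dyn_alg) (P : cmd),
    dynamic_alg C A -> library_in (procedure_of A) P -> linear_own_time P ->
    static_alg C P.

Definition clique4_hypothesis (C : algorithm_class) : Prop :=
  forall eps : R, (0 < eps)%coqR ->
    ~ (exists P : cmd, static_alg C P /\ decides_clique4 P (4 - eps)%coqR).

(* Total time n ^ (4 - o(1)) is required: time O(n ^ (4 - eps)) is impossible
   for every constant eps > 0. *)
Definition stBP_requires_n4 (C : algorithm_class) (K : setting) : Prop :=
  forall eps : R, (0 < eps)%coqR ->
    ~ (exists A : dyn_alg, dynamic_alg C A /\ solves_stBP K A (4 - eps)%coqR).

(* Main.v *)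
(* The reduction uses the layers s, A, B, C, X, C', D, Y, D', B', A', t, all of
   size n, and arcs between consecutive layers only.  Every arc is inserted at
   a time l and has an expiry time r; its weight is r + 2, or just 1 if the
   input graph lacks the edge that the arc stands for.  So after m insertions
   there is an s-t path of width > m iff there is a path all of whose arcs
   stand for edges and satisfy l < m <= r + 1: one sequence of insertions
   simulates arcs that live during arbitrary intervals of time.  The arcs
   a -> b and b' -> a' are alive together only at a moment of their own, which
   forces a' = a and b' = b.  To test that c is a neighbour of a without
   forgetting c, the path goes from c to c' through the vertex c + a mod n
   of X, by two arcs which live during the block of a only; this forces c' = c,
   and since the arcs differ for different a, none has to be inserted twice.
   The vertex d is treated likewise, and the other arcs never expire.  There
   are 11 n^2 arcs on 12 n vertices.  Running the sequence backwards gives the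
   decremental case. *)

Set Warnings "-notation-overridden".
From Stdlib Require Import Reals Lra FunctionalExtensionality.
From mathcomp Require Import all_boot zify.
Require Import Defs.

Set Implicit Arguments.
Unset Strict Implicit.
Unset Printing Implicit Defensive.


(** * Executions under a word bound and total-correctness triples *)

(** The bound [B] occurs only as an upper limit on written values. This lets procedures whose bound
    is stated for graphs on [12 * n] vertices run under the bound of the calling program. *)
Lemma exec_mono B B' c s own lib s' :
  B <= B' -> exec B c s own lib s' -> exec B' c s own lib s'.
Proof.
move=> leB; elim=> {c s own lib s'}; try by econstructor; eauto.
- by move=> s x v lt; apply: ExConst; apply: leq_trans leB.
- by move=> s o x y z lt; apply: ExOp; apply: leq_trans leB.
- by move=> s x a y lt; apply: ExLoad; apply: leq_trans leB.
Qed.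

Lemma exec_op B o x y z s v :
  eval_binop o (reg s y) (reg s z) = v -> v < B ->
  exec B (COp o x y z) s 1 0 (set_reg s x v).
Proof. by move=> <-; apply: ExOp. Qed.

Lemma exec_load B x a y s v :
  arr s a (reg s y) = v -> v < B -> exec B (CLoad x a y) s 1 0 (set_reg s x v).
Proof. by move=> <-; apply: ExLoad. Qed.

(** A total-correctness triple that is exact about library time only. Own time stays existential
    because [program_linear] bounds it separately, for every run. *)
Definition runs (B : nat) (c : cmd) (s : store) (l : nat) (Q : store -> Prop) :=
  exists own s', exec B c s own l s' /\ Q s'.

Lemma runs_weaken B c s l (Q R : store -> Prop) :
  runs B c s l Q -> (forall s', Q s' -> R s') -> runs B c s l R.
Proof. by case=> own [s' [ex Qs]] QR; exists own, s'; split; auto. Qed.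

Lemma runs_seq B c d s l1 l2 (R Q : store -> Prop) :
  runs B c s l1 R -> (forall s1, R s1 -> runs B d s1 l2 Q) ->
  runs B (CSeq c d) s (l1 + l2) Q.
Proof.
case=> own1 [s1 [ex1 Rs]] /(_ _ Rs) [own2 [s2 [ex2 Qs]]].
by exists (own1 + own2), s2; split=> //; apply: ExSeq ex1 ex2.
Qed.

Lemma runs_seq0 B c d s l (R Q : store -> Prop) :
  runs B c s 0 R -> (forall s1, R s1 -> runs B d s1 l Q) ->
  runs B (CSeq c d) s l Q.
Proof. exact: runs_seq. Qed.

(** * Library calls *)

Definition odd_name (x : nat) := x.*2.+1.

Definition hosts (S s : store) : Prop :=
  (forall x, reg S (odd_name x) = reg s x) /\
  (forall a i, arr S (odd_name a) i = arr s a i).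

Definition same_even (S S' : store) : Prop :=
  (forall x, ~~ odd x -> reg S' x = reg S x) /\
  (forall a i, ~~ odd a -> arr S' a i = arr S a i).

Lemma same_even_trans S1 S2 S3 :
  same_even S1 S2 -> same_even S2 S3 -> same_even S1 S3.
Proof.
move=> [r1 a1] [r2 a2]; split=> [x ev|a i ev]; first by rewrite r2 // r1.
by rewrite a2 // a1.
Qed.

Lemma odd_name_eq x y : (odd_name x == odd_name y) = (x == y).
Proof. by apply/eqP/eqP => [|->] //; rewrite /odd_name; lia. Qed.

Lemma even_neq_odd_name x y : ~~ odd x -> (x == odd_name y) = false.
Proof. by move=> ev; apply/eqP => E; move: ev; rewrite E /odd_name /= odd_double. Qed.

Lemma hosts_set_reg S s x v :
  hosts S s -> hosts (set_reg S (odd_name x) v) (set_reg s x v).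
Proof. by move=> [hr ha]; split=> [y|a i] /=; rewrite ?odd_name_eq ?hr ?ha. Qed.

Lemma hosts_set_arr S s a i v :
  hosts S s -> hosts (set_arr S (odd_name a) i v) (set_arr s a i v).
Proof. by move=> [hr ha]; split=> [y|b j] /=; rewrite ?odd_name_eq ?hr ?ha. Qed.

Lemma same_even_set_reg S x v : same_even S (set_reg S (odd_name x) v).
Proof. by split=> //= y ev; rewrite even_neq_odd_name. Qed.

Lemma same_even_set_arr S a i v : same_even S (set_arr S (odd_name a) i v).
Proof. by split=> //= b j ev; rewrite even_neq_odd_name. Qed.

(** A step-by-step simulation: [odd_name] is injective, so distinct names stay distinct, and its
    values are odd, so the caller's even half is untouched. *)
Lemma exec_rename B c s own lib s' :
  exec B c s own lib s' -> forall S, hosts S s ->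
  exists S', [/\ exec B (rename odd_name c) S own lib S', hosts S' s'
               & same_even S S'].
Proof.
elim=> {c s own lib s'} /=.
- by move=> s S hS; exists S; split=> //; apply: ExSkip.
- move=> s x v lt S hS; exists (set_reg S (odd_name x) v); split.
  + exact: ExConst.
  + exact: hosts_set_reg.
  + exact: same_even_set_reg.
- move=> s o x y z lt S hS; have [hr _] := hS.
  exists (set_reg S (odd_name x) (eval_binop o (reg s y) (reg s z))); split.
  + by apply: exec_op; rewrite ?hr.
  + exact: hosts_set_reg.
  + exact: same_even_set_reg.
- move=> s x a y lt S hS; have [hr ha] := hS.
  exists (set_reg S (odd_name x) (arr s a (reg s y))); split.
  + by apply: exec_load; rewrite ?hr ?ha.
  + exact: hosts_set_reg.
  + exact: same_even_set_reg.
- move=> s a x y S hS; have [hr ha] := hS.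
  exists (set_arr S (odd_name a) (reg s x) (reg s y)); split.
  + by rewrite -!hr; apply: ExStore.
  + exact: hosts_set_arr.
  + exact: same_even_set_arr.
- move=> c d s s1 s2 own lib own' lib' _ IH1 _ IH2 S /IH1 [S1 [e1 /IH2]].
  move=> [S2 [e2 h2 t2]] t1; exists S2; split=> //; first exact: ExSeq e1 e2.
  exact: same_even_trans t1 t2.
- move=> x c d s s1 own lib nz _ IH S hS.
  have [S1 [e1 h1 t1]] := IH _ hS; exists S1; split=> //; apply: ExIfT e1.
  by case: hS => ->.
- move=> x c d s s1 own lib nz _ IH S hS.
  have [S1 [e1 h1 t1]] := IH _ hS; exists S1; split=> //; apply: ExIfF e1.
  by case: hS => ->.
- move=> x c s s1 s2 own lib own' lib' nz _ IH1 _ IH2 S hS.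
  have [S1 [e1 h1 t1]] := IH1 _ hS; have [S2 [e2 h2 t2]] := IH2 _ h1.
  exists S2; split=> //; last exact: same_even_trans t1 t2.
  by apply: ExWhileT e1 e2; case: hS => ->.
- move=> x c s z S hS; exists S; split=> //.
  by apply: ExWhileF; case: hS => ->.
- move=> c s s1 own lib _ IH S /IH [S1 [e1 h1 t1]].
  by exists S1; split=> //; apply: ExLib e1.
Qed.

Lemma runs_call B c s own lib s' S :
  exec B c s own lib s' -> hosts S s ->
  runs B (CLib (rename odd_name c)) S (own + lib)
    (fun S' => hosts S' s' /\ same_even S S').
Proof.
move=> ex hS; have [S' [ex' h' t']] := exec_rename ex hS.
by exists 1, S'; split=> //; apply: ExLib.
Qed.

(** * Own running time *)

Fixpoint writes (x : nat) (c : cmd) : bool :=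
  match c with
  | CSkip | CStore _ _ _ => false
  | CConst y _ | COp _ y _ _ | CLoad y _ _ => y == x
  | CSeq c d | CIf _ c d => writes x c || writes x d
  | CWhile _ c | CLib c => writes x c
  end.

Lemma exec_unwritten B c s own lib s' x :
  exec B c s own lib s' -> ~~ writes x c -> reg s' x = reg s x.
Proof.
elim=> {c s own lib s'} //=.
- by move=> s y v _ /negPf; rewrite eq_sym => ->.
- by move=> s o y z w _ /negPf; rewrite eq_sym => ->.
- by move=> s y a z _ /negPf; rewrite eq_sym => ->.
- move=> c d s s1 s2 _ _ _ _ _ IH1 _ IH2; rewrite negb_or => /andP[n1 n2].
  by rewrite IH2 // IH1.
- by move=> y c d s s1 _ _ _ _ IH; rewrite negb_or => /andP[n1 n2]; apply: IH.
- by move=> y c d s s1 _ _ _ _ IH; rewrite negb_or => /andP[n1 n2]; apply: IH.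
- by move=> y c s s1 s2 _ _ _ _ _ _ IH1 _ IH2 nw; rewrite IH2 // IH1.
Qed.

Lemma writes_rename x c : ~~ odd x -> writes x (rename odd_name c) = false.
Proof.
move=> ev; have ne y : (odd_name y == x) = false.
  by rewrite eq_sym even_neq_odd_name.
by elim: c => //= [c -> d ->|y c -> d ->].
Qed.

(** A library call passes whatever loops it contains, since it costs a single own step. *)
Fixpoint loopfree (c : cmd) : bool :=
  match c with
  | CSeq c d | CIf _ c d => loopfree c && loopfree d
  | CWhile _ _ => false
  | _ => true
  end.

Fixpoint cmd_size (c : cmd) : nat :=
  match c with
  | CSkip => 0
  | CSeq c d => cmd_size c + cmd_size d
  | CIf _ c d => (cmd_size c + cmd_size d).+1
  | _ => 1
  end.

Lemma loopfree_own B c s own lib s' :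
  exec B c s own lib s' -> loopfree c -> own <= cmd_size c.
Proof.
elim=> {c s own lib s'} //=.
- move=> c d s s1 s2 own lib own' lib' _ IH1 _ IH2 /andP[/IH1 le1 /IH2 le2].
  exact: leq_add.
- move=> x c d s s1 own lib _ _ IH /andP[/IH le1 _]; lia.
- move=> x c d s s1 own lib _ _ IH /andP[_ /IH le1]; lia.
Qed.

(* Register 2 is the counter of every loop; even registers from 20 on are
   scratch space. *)
Definition countdown (c : cmd) : cmd :=
  CWhile 2 (CSeq c (CSeq (CConst 20 1) (COp Sub 2 2 20))).

(** As the body cannot write register 2, the counter drops by exactly one per round. A round costs
    the body, two steps for the decrement and one test; the final [1] is the failing test. *)
Lemma countdown_own B c s own lib s' :
  loopfree c -> ~~ writes 2 c -> exec B (countdown c) s own lib s' ->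
  own <= reg s 2 * (cmd_size c + 4) + 1.
Proof.
move=> lf nw; move E: (countdown c) => d ex.
elim: ex E => // {d s own lib s'}.
- move=> x d s s1 s2 own lib own' lib' nz ex1 _ _ IH [Ex Ed].
  have {}IH := IH; rewrite -Ed -Ex in IH; have {}IH := IH erefl.
  rewrite -Ex in nz; rewrite -Ed in ex1.
  inversion ex1 as [| | | | |? ? ? t1 ? o1 l1 o2 l2 exc exd| | | | |]; subst.
  have := exec_unwritten exc nw => E1.
  have le1 := loopfree_own exc lf.
  inversion exd as [| | | | |? ? ? t2 ? o3 l3 o4 l4 ex3 ex4| | | | |]; subst.
  inversion ex3; subst; inversion ex4; subst.
  move: IH; rewrite /= E1 => IH.
  have [k Ek] : exists k, reg s 2 = k.+1 by case: (reg s 2) nz => // k _; exists k.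
  move: IH; rewrite Ek subn1 /=; lia.
- by move=> *; lia.
Qed.

Lemma runs_countdown0 B c s (Q : store -> Prop) :
  reg s 2 = 0 -> Q s -> runs B (countdown c) s 0 Q.
Proof. by move=> z Qs; exists 1, s; split=> //; apply: ExWhileF. Qed.

Lemma runs_countdownS B c s k l1 l2 (R Q : store -> Prop) :
  1 < B -> k < B -> ~~ writes 2 c -> reg s 2 = k.+1 -> runs B c s l1 R ->
  (forall s1, R s1 ->
     runs B (countdown c) (set_reg (set_reg s1 20 1) 2 k) l2 Q) ->
  runs B (countdown c) s (l1 + l2) Q.
Proof.
move=> B1 kB nw Ek [own1 [s1 [ex1 Rs]]] /(_ _ Rs) [own2 [s2 [ex2 Qs]]].
set t := set_reg s1 20 1 in ex2.
have Et : eval_binop Sub (reg t 2) (reg t 20) = k.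
  by rewrite /t /= (exec_unwritten ex1 nw) Ek subn1.
exists (own1 + (1 + 1) + own2).+1, s2; split=> //.
apply: ExWhileT ex2; first by rewrite Ek.
rewrite -[l1]addn0; apply: ExSeq ex1 _.
rewrite -[X in exec _ _ _ _ X _]/(0 + 0).
apply: ExSeq; first exact: ExConst.
exact: exec_op Et _.
Qed.

(* Register 0 holds n; there are 11 n^2 slots. *)
Definition phase (c : cmd) : cmd :=
  CSeq (CSeq (CConst 20 11) (CSeq (COp Mul 22 0 0) (COp Mul 2 20 22)))
       (countdown c).

Lemma phase_own B c s own lib s' :
  loopfree c -> ~~ writes 2 c -> exec B (phase c) s own lib s' ->
  own <= 11 * (reg s 0 * reg s 0) * (cmd_size c + 4) + 4.
Proof.
move=> lf nw ex.
inversion ex as [| | | | |? ? ? t1 ? o1 l1 o2 l2 exc exd| | | | |]; subst.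
have le1 := loopfree_own exc isT; have := countdown_own lf nw exd.
inversion exc as [| | | | |? ? ? t2 ? o3 l3 o4 l4 ex3 ex4| | | | |]; subst.
inversion ex4 as [| | | | |? ? ? t3 ? o5 l5 o6 l6 ex5 ex6| | | | |]; subst.
inversion ex3; subst; inversion ex5; subst; inversion ex6; subst.
move: le1; rewrite /=; lia.
Qed.

Definition start_phase (s : store) : store :=
  set_reg (set_reg (set_reg s 20 11) 22 (reg s 0 * reg s 0)) 2
    (11 * (reg s 0 * reg s 0)).

Lemma runs_phase B c s l (Q : store -> Prop) :
  11 < B -> 11 * (reg s 0 * reg s 0) < B ->
  runs B (countdown c) (start_phase s) l Q -> runs B (phase c) s l Q.
Proof.
move=> B11 BT R; apply: (runs_seq0 (R := eq (start_phase s))) => [|s1 <- //].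
exists (1 + (1 + 1)), (start_phase s); split=> //.
rewrite -[X in exec _ _ _ _ X _]/(0 + (0 + 0)).
apply: ExSeq; first exact: ExConst.
apply: ExSeq; first by apply: ExOp => /=; lia.
exact: ExOp.
Qed.

(** * Expressions *)

Inductive expr : Set :=
  | EConst (k : nat)
  | EReg (x : nat)
  | EOp (o : binop) (e f : expr)
  | ELoad (a : nat) (e : expr).

Fixpoint eval (s : store) (e : expr) : nat :=
  match e with
  | EConst k => k
  | EReg x => reg s x
  | EOp o e f => eval_binop o (eval s e) (eval s f)
  | ELoad a e => arr s a (eval s e)
  end.

(** The result goes to [d], temporaries to [d], [d.+2] and so on, which are even when [d] is. There
    is no move instruction, so a register is copied by adding it to 0. *)
Fixpoint compile (e : expr) (d : nat) : cmd :=
  match e with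
  | EConst k => CConst d k
  | EReg x => CSeq (CConst d 0) (COp Add d x d)
  | EOp o e f => CSeq (compile e d) (CSeq (compile f d.+2) (COp o d d d.+2))
  | ELoad a e => CSeq (compile e d) (CLoad d a d)
  end.

Lemma compile_loopfree e d : loopfree (compile e d).
Proof. by elim: e d => //= [o e IHe f IHf d|a e IH d]; rewrite ?IHe ?IHf ?IH. Qed.

(* Scratch registers are not part of the meaning of a state. *)
Definition agree (d : nat) (s s' : store) : Prop :=
  arr s' = arr s /\ forall x, odd x || (x < d) -> reg s' x = reg s x.

(** Operations whose results stay below the product of two bounds greater than 1 on the arguments; a
    left shift would break this. *)
Definition arith (o : binop) : bool :=
  match o with Add | Sub | Mul | Div | Mod | Eq | Lt => true | _ => false end.

Fixpoint wf (regs : pred nat) (e : expr) : bool :=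
  match e with
  | EConst _ => true
  | EReg x => regs x
  | EOp o e f => [&& arith o, wf regs e & wf regs f]
  | ELoad a e => (a == 0) && wf regs e
  end.

Lemma eval_agree (regs : pred nat) d e s s' :
  (forall x, regs x -> x < d) -> wf regs e -> agree d s s' ->
  eval s' e = eval s e.
Proof.
move=> small + [aE rE]; elim: e => //= [x /small lt|o e IHe f IHf /and3P[_ we wf']|a e IH].
- by rewrite rE ?lt ?orbT.
- by rewrite IHe ?IHf.
- by case/andP=> _ we; rewrite IH // aE.
Qed.

(* Values of e lie below M ^ edeg b e if its inputs lie below M ^ b. *)
Fixpoint edeg (b : nat) (e : expr) : nat :=
  match e with
  | EConst k => k.+1
  | EReg _ => b
  | EOp _ e f => edeg b e + edeg b f
  | ELoad _ e => edeg b e + b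
  end.

Section Compile.
Variables (regs : pred nat) (M b : nat) (s : store).
Hypotheses (M2 : 1 < M) (b0 : 0 < b)
  (reg_small : forall x, regs x -> reg s x < M ^ b)
  (arr_small : forall i, arr s 0 i < M ^ b).

Lemma edeg_gt0 e : 0 < edeg b e.
Proof. by elim: e => //= [o e IHe f IHf|a e IH]; lia. Qed.

Lemma expn_gt1 d : 0 < d -> 1 < M ^ d.
Proof. by move=> d0; rewrite -(exp1n d) ltn_exp2r. Qed.

Lemma eval_small e : wf regs e -> eval s e < M ^ edeg b e.
Proof.
elim: e => /= [k _|x|o e IHe f IHf /and3P[ar /IHe lte /IHf ltf]|a e IH].
(* [k < M ^ k] already holds; the exponent [k.+1] keeps the degree positive when [k] is 0. *)
- by apply: ltn_trans (ltn_expl k M2) _; rewrite ltn_exp2l.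
- exact/reg_small.
- have X1 := expn_gt1 (edeg_gt0 e); have Y1 := expn_gt1 (edeg_gt0 f).
  rewrite expnD; move: lte ltf X1 Y1.
  move: (eval s e) (eval s f) (M ^ edeg b e) (M ^ edeg b f) => x y X Y ltx lty X1 Y1.
  have XX : X <= X * Y by apply: leq_pmulr; lia.
  case: o ar => //= _.
  + have := leq_mul X1 (leqnn Y); have := leq_mul (leqnn X) Y1.
    by lia.
  + by lia.
  + by rewrite ltn_mul.
  + exact: leq_ltn_trans (leq_div _ _) (leq_trans ltx XX).
  + exact: leq_ltn_trans (leq_mod _ _) (leq_trans ltx XX).
  + by apply: leq_ltn_trans (leq_b1 _) _; lia.
  + by apply: leq_ltn_trans (leq_b1 _) _; lia.
- case/andP=> /eqP-> _; apply: leq_trans (arr_small _) _.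
  by rewrite leq_exp2l // leq_addl.
Qed.

End Compile.

Lemma agree_trans d s1 s2 s3 : agree d s1 s2 -> agree d s2 s3 -> agree d s1 s3.
Proof.
by move=> [a1 r1] [a2 r2]; split=> [|x kx]; [rewrite a2|rewrite r2 ?r1].
Qed.

Lemma agree_scratch d s v : ~~ odd d -> agree d s (set_reg s d v).
Proof.
by move=> ev; split=> //= y; case: eqP => // ->; rewrite (negPf ev) ltnn.
Qed.

(** The second operand of an operation uses scratch space from [d.+2] on, so the first one survives
    in [d]. Degrees of subexpressions are at most that of [e], hence one bound on [B] covers all
    intermediate values. *)
Lemma compile_exec (regs : pred nat) M b B e d s :
  1 < M -> 0 < b -> (forall x, regs x -> x < d) ->
  (forall x, regs x -> reg s x < M ^ b) -> (forall i, arr s 0 i < M ^ b) ->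
  ~~ odd d -> wf regs e -> M ^ edeg b e <= B ->
  exists own s', [/\ exec B (compile e d) s own 0 s', agree d s s'
                   & reg s' d = eval s e].
Proof.
move=> M2 b0; elim: e d s => /= [k|x|o e IHe f IHf|a e IH] d s small rs as_ ev.
- move=> _ leB; exists 1, (set_reg s d k); split.
  + by apply: ExConst; apply: leq_trans leB; apply: ltn_trans (ltn_expl k M2) _; rewrite ltn_exp2l.
  + exact: agree_scratch.
  + by rewrite /= eqxx.
- move=> rx leB; have lt := rs _ rx; have nx : (x == d) = false.
    by apply/eqP => E; move: (small _ rx); rewrite E ltnn.
  have val : eval_binop Add (reg (set_reg s d 0) x) (reg (set_reg s d 0) d) = reg s x.
    by rewrite /= nx eqxx addn0.
  exists (1 + 1), (set_reg (set_reg s d 0) d (reg s x)); split.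
  + rewrite -[X in exec _ _ _ _ X _]/(0 + 0).
    apply: ExSeq; first by apply: ExConst; lia.
    by apply: exec_op val _; lia.
  + split=> //= y ky; case: eqP => // E; move: ky; rewrite E (negPf ev) ltnn //.
  + by rewrite /= eqxx.
- case/and3P=> ar we wf' leB.
  have small_e := eval_small M2 b0 rs as_ we.
  have lt : eval_binop o (eval s e) (eval s f) < B.
    have w : wf regs (EOp o e f) by rewrite /= ar we.
    exact: leq_trans (eval_small M2 b0 rs as_ w) leB.
  have leBe : M ^ edeg b e <= B by apply: leq_trans leB; rewrite leq_exp2l // leq_addr.
  have leBf : M ^ edeg b f <= B by apply: leq_trans leB; rewrite leq_exp2l // leq_addl.
  have [o1 [s1 [ex1 ag1 v1]]] := IHe d s small rs as_ ev we leBe.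
  have rs1 x : regs x -> reg s1 x < M ^ b.
    by move=> rx; rewrite (proj2 ag1) ?small ?orbT //; apply: rs.
  have as1 i : arr s1 0 i < M ^ b by rewrite (proj1 ag1).
  have small2 x : regs x -> x < d.+2 by move=> /small; lia.
  have ev2 : ~~ odd d.+2 by rewrite /= negbK.
  have [o2 [s2 [ex2 ag2 v2]]] := IHf d.+2 s1 small2 rs1 as1 ev2 wf' leBf.
  have Ev : eval_binop o (reg s2 d) (reg s2 d.+2) = eval s (EOp o e f).
    rewrite v2 (eval_agree small wf' ag1) (proj2 ag2) ?v1 //.
    by rewrite leqW ?orbT.
  exists (o1 + (o2 + 1)), (set_reg s2 d (eval s (EOp o e f))); split.
  + rewrite -[X in exec _ _ _ _ X _]/(0 + (0 + 0)).
    apply: ExSeq ex1 _; apply: ExSeq ex2 _.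
    exact: exec_op Ev _.
  + apply: agree_trans ag1 _; split=> [/=|y ky /=]; first exact: (proj1 ag2).
    case: eqP ky => [->|_ ky]; first by rewrite (negPf ev) ltnn.
    by apply: (proj2 ag2); case/orP: ky => [->//|lt']; rewrite ltnW ?orbT // ltnW // ltnS.
  + by rewrite /= eqxx.
- case/andP=> /eqP-> we leB.
  have leBe : M ^ edeg b e <= B by apply: leq_trans leB; rewrite leq_exp2l // leq_addr.
  have [o1 [s1 [ex1 ag1 v1]]] := IH d s small rs as_ ev we leBe.
  have Ev : arr s1 0 (reg s1 d) = arr s 0 (eval s e) by rewrite v1 (proj1 ag1).
  exists (o1 + 1), (set_reg s1 d (arr s 0 (eval s e))); split.
  + rewrite -[X in exec _ _ _ _ X _]/(0 + 0); apply: ExSeq ex1 _.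
    apply: exec_load Ev _; apply: leq_trans (as_ _) _.
    by apply: leq_trans leB; rewrite leq_exp2l // leq_addl.
  + apply: agree_trans ag1 _; split=> //= y ky; case: eqP ky => // ->.
    by rewrite (negPf ev) ltnn.
  + by rewrite /= eqxx.
Qed.

Definition assign (x : nat) (e : expr) : cmd :=
  CSeq (compile e 20) (CSeq (CConst 22 0) (COp Add x 20 22)).

(* Every value the program handles is below (n + 2) ^ 10. *)
Lemma runs_assign (regs : pred nat) M B x e s :
  1 < M -> (forall y, regs y -> y < 20) ->
  (forall y, regs y -> reg s y < M ^ 10) -> (forall i, arr s 0 i < M ^ 10) ->
  wf regs e -> M ^ edeg 10 e <= B ->
  runs B (assign x e) s 0 (agree 20 (set_reg s x (eval s e))).
Proof.
move=> M2 small rs as_ we leB.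
have [o1 [s1 [ex1 [a1 r1] v1]]] :=
  compile_exec M2 (isT : 0 < 10) small rs as_ (isT : ~~ odd 20) we leB.
have lt := leq_trans (eval_small M2 (isT : 0 < 10) rs as_ we) leB.
have Ev : eval_binop Add (reg (set_reg s1 22 0) 20) (reg (set_reg s1 22 0) 22)
    = eval s e by rewrite /= v1 addn0.
exists (o1 + (1 + 1)), (set_reg (set_reg s1 22 0) x (eval s e)); split.
- rewrite -[X in exec _ _ _ _ X _]/(0 + (0 + 0)).
  apply: ExSeq ex1 _; apply: ExSeq; first by apply: ExConst; lia.
  exact: exec_op Ev _.
- split=> //= y ky; case: eqP => // _.
  by case: eqP ky => [->|_ /r1].
Qed.

(** * The order of the slots *)

Declare Scope code_scope.
Delimit Scope code_scope with code.

(* Written once for any type of terms: with [num := id] and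
   [op := eval_binop] the codes are numbers, with [EConst] and [EOp] they are
   the expressions by which the program computes these numbers. *)
Section Code.
Variables (T : Type) (num : nat -> T) (op : binop -> T -> T -> T).

Local Notation "x + y" := (op Add x y) : code_scope.
Local Notation "x - y" := (op Sub x y) : code_scope.
Local Notation "x * y" := (op Mul x y) : code_scope.
Local Notation "x / y" := (op Div x y) : code_scope.
Local Notation "x 'mod' y" := (op Mod x y) (at level 40) : code_scope.
Local Notation "x =? y" := (op Eq x y) (at level 70) : code_scope.
Local Notation "x < y" := (op Lt x y) : code_scope.
Local Open Scope code_scope.

(** A conditional without branching, for [c] in {0, 1}; it keeps the codes purely arithmetical. *)
Definition ite_code (c x y : T) : T := c * x + (num 1 - c) * y.

Variables (n t : T).

Definition static_code : T := t < num 5 * (n * n).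
Definition kind_code : T := t / (n * n).
Definition block_code : T := (t - num 5 * (n * n)) / (num 6 * n).
Definition offset_code : T := (t - num 5 * (n * n)) mod (num 6 * n).
Definition gate_code : T := offset_code < num 4 * n.
Definition gate_kind_code : T := offset_code / n.
Definition gated_code : T := offset_code mod n.
Definition shift_code : T := (gated_code + block_code) mod n.
Definition point_code : T := (offset_code - num 4 * n) / num 2.
Definition point_kind_code : T := (offset_code - num 4 * n) mod num 2.

(** Static kinds 0, ..., 4 go to the layers 0, 2, 5, 8, 10, where kind 0 relies on truncated
    subtraction. The four gate kinds go to 3, 4, 6, 7 and the two point kinds to 1 and 9. *)
Definition layer_code : T :=
  ite_code static_code
    (num 3 * kind_code - num 1 - (kind_code =? num 4))
    (ite_code gate_code (num 3 + gate_kind_code + gate_kind_code / num 2)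
                        (num 1 + num 8 * point_kind_code)).

Definition source_code : T :=
  ite_code static_code ((t / n) mod n)
    (ite_code gate_code
       (ite_code (gate_kind_code mod num 2) shift_code gated_code)
       (ite_code point_kind_code point_code block_code)).

Definition target_code : T :=
  ite_code static_code (t mod n)
    (ite_code gate_code
       (ite_code (gate_kind_code mod num 2) gated_code shift_code)
       (ite_code point_kind_code block_code point_code)).

Definition tail_code : T := layer_code * n + source_code.
Definition head_code : T := (layer_code + num 1) * n + target_code.

Definition free_code : T :=
  static_code * ((kind_code =? num 0) + (kind_code =? num 4)).

(* The edge of the input graph on which the weight of the slot depends. *)
Definition probe_code : T :=
  ite_code static_code ((t / n) mod n) block_code * n +
  ite_code static_code (t mod n) (ite_code gate_code gated_code point_code).

Definition expiry_code : T :=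
  ite_code static_code (num 11 * (n * n))
    (ite_code gate_code
       (num 5 * (n * n) + block_code * (num 6 * n) + (num 6 * n - num 1))
       (t + (num 1 - point_kind_code))).

Definition weight_code (adj : T) : T :=
  num 1 + (num 0 < free_code + adj) * (expiry_code + num 1).

End Code.

Notation at_nat f := (f nat id eval_binop) (only parsing).

(* Slot (i, x, y) stands for the arc from vertex x of layer i to vertex y of
   layer i + 1.  [stamp n i x y] is its position in the order of insertion. *)
Definition block_start (n a : nat) : nat := 5 * (n * n) + a * (6 * n).
Definition point_start (n a b : nat) : nat := block_start n a + (4 * n + b * 2).
(** The difference x - c modulo n: the block [a] to which the gate between [c] and the vertex [x] of
    X or Y belongs. *)
Definition unshift (n x c : nat) : nat := (x + n - c) %% n.

Definition stamp (n i x y : nat) : nat :=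
  match i with
  | 0 => x * n + y
  | 2 => 1 * (n * n) + (x * n + y)
  | 5 => 2 * (n * n) + (x * n + y)
  | 8 => 3 * (n * n) + (x * n + y)
  | 10 => 4 * (n * n) + (x * n + y)
  | 1 => point_start n x y
  | 9 => (point_start n y x).+1
  | 3 => block_start n (unshift n y x) + (0 * n + x)
  | 4 => block_start n (unshift n x y) + (1 * n + y)
  | 6 => block_start n (unshift n y x) + (2 * n + x)
  | _ => block_start n (unshift n x y) + (3 * n + y)
  end.

(* The last stamp at which the slot is still in use. *)
Definition expiry (n i x y : nat) : nat :=
  match i with
  | 0 | 2 | 5 | 8 | 10 => 11 * (n * n)
  | 1 => (point_start n x y).+1
  | 9 => (point_start n y x).+1
  | 3 | 6 => block_start n (unshift n y x) + (6 * n - 1)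
  | _ => block_start n (unshift n x y) + (6 * n - 1)
  end.

Definition usable (n : nat) (adj : nat -> nat) (i x y : nat) : bool :=
  match i with
  | 0 | 10 => true
  | 1 | 2 | 5 | 8 => 0 < adj (x * n + y)
  | 9 => 0 < adj (y * n + x)
  | 3 | 6 => 0 < adj (unshift n y x * n + x)
  | _ => 0 < adj (unshift n x y * n + y)
  end.

Definition slot_weight (n : nat) (adj : nat -> nat) (i x y : nat) : nat :=
  if usable n adj i x y then (expiry n i x y).+2 else 1.

(** * Shifts modulo [n], and the decoding of positions into slots *)

Lemma modn_once m n : m < n + n -> m %% n = if m < n then m else m - n.
Proof.
case: (ltnP m n) => [lt _|le lt]; first by rewrite modn_small.
rewrite -{1}(subnK le) modnDr modn_small //; lia.
Qed.

Lemma unshiftK n c a : c < n -> a < n -> unshift n ((c + a) %% n) c = a.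
Proof.
move=> cn an; rewrite /unshift (@modn_once (c + a)); last by lia.
by case: ltnP => le; (rewrite modn_once; last by lia); case: ltnP; lia.
Qed.

Lemma unshift_lt n x c : x < n -> unshift n x c < n.
Proof. by move=> xn; rewrite ltn_mod; lia. Qed.

Lemma shiftK n x c : x < n -> c < n -> (c + unshift n x c) %% n = x.
Proof.
move=> xn cn; rewrite /unshift (@modn_once (x + n - c)); last by lia.
by case: ltnP => le; (rewrite modn_once; last by lia); case: ltnP; lia.
Qed.

Lemma divmod2 q r n : r < n -> ((q * n + r) %/ n = q) * ((q * n + r) %% n = r).
Proof.
move=> rn; split; last by rewrite modnMDl modn_small.
by rewrite divnMDl ?divn_small ?addn0; lia.
Qed.

(** Positions in mixed radix: five full families of static slots, then for each [a] a block of
    [4 * n] gates followed by [2 * n] point slots, the two belonging to [b] being adjacent. *)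
Variant slot_spec (n : nat) : nat -> Prop :=
  | StaticSlot k x y of k < 5 & x < n & y < n :
      slot_spec n (k * (n * n) + (x * n + y))
  | GateSlot a g c of a < n & g < 4 & c < n :
      slot_spec n (block_start n a + (g * n + c))
  | PointSlot a b p of a < n & b < n & p < 2 :
      slot_spec n (point_start n a b + p).

Lemma slotP n t : t < 11 * (n * n) -> slot_spec n t.
Proof.
move=> lt; have n0 : 0 < n by move: lt; case: (n) => //; rewrite !muln0.
have nn0 : 0 < n * n by rewrite muln_gt0 n0.
case: (ltnP t (5 * (n * n))) => [lts|ges].
  rewrite (divn_eq t (n * n)) (divn_eq (t %% (n * n)) n).
  by apply: StaticSlot; rewrite ?ltn_mod // ltn_divLR ?ltn_mod.
rewrite -(subnKC ges); have {lt} : t - 5 * (n * n) < n * (6 * n) by lia.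
move: (t - _) => {ges} {}t lt.
have n6 : 0 < 6 * n by lia.
have an : t %/ (6 * n) < n by rewrite ltn_divLR.
rewrite (divn_eq t (6 * n)) addnA -/(block_start n _).
have : t %% (6 * n) < 6 * n by rewrite ltn_mod.
move: (t %/ _) (t %% _) an => a r an {lt} {}lt.
case: (ltnP r (4 * n)) => [ltr|ger].
  by rewrite (divn_eq r n); apply: GateSlot; rewrite ?ltn_mod // ltn_divLR.
rewrite -(subnKC ger); have {lt} : r - 4 * n < n * 2 by lia.
move: (r - _) => {ger} {}r lt.
have -> : block_start n a + (4 * n + r) = point_start n a (r %/ 2) + r %% 2.
  by rewrite /point_start; have := divn_eq r 2; lia.
by apply: PointSlot; rewrite ?ltn_mod // ltn_divLR.
Qed.

(** The flag [fr] marks the slots at s and t, which stand for no edge; the probe is prescribed for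
    the others only. *)
Definition decodes (n t i x y p : nat) (fr : bool) : Prop :=
  [/\ at_nat layer_code n t = i, at_nat source_code n t = x,
      at_nat target_code n t = y
    & [/\ (0 < at_nat free_code n t) = fr,
      ~~ fr -> at_nat probe_code n t = p
    & at_nat expiry_code n t = expiry n i x y]].

Lemma iteT x y : true * x + (1 - true) * y = x.
Proof. by rewrite mul1n subnn addn0. Qed.

Lemma iteF x y : false * x + (1 - false) * y = y.
Proof. by rewrite mul1n. Qed.

Lemma decode_static n k x y :
  k < 5 -> x < n -> y < n ->
  decodes n (k * (n * n) + (x * n + y)) (3 * k - 1 - (k == 4)) x y (x * n + y)
    ((k == 0) || (k == 4)).
Proof.
move=> k5 xn yn; set t := _ + (_ + _).
have xyn : x * n + y < n * n by nia.
have st : t < 5 * (n * n) by rewrite /t; nia.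
have kE : t %/ (n * n) = k by rewrite /t divmod2.
have xE : (t %/ n) %% n = x.
  have -> : t = (k * n + x) * n + y by rewrite /t; lia.
  by rewrite !divmod2.
have yE : t %% n = y.
  have -> : t = (k * n + x) * n + y by rewrite /t; lia.
  by rewrite !divmod2.
rewrite /decodes /layer_code /source_code /target_code /free_code /probe_code
  /expiry_code /ite_code /static_code /kind_code /= st kE xE yE !iteT.
rewrite [true * _]mul1n.
by case: k k5 {t st kE xE yE} => [|[|[|[|[|]]]]] //= _; do !split.
Qed.

Lemma decode_block n a r :
  r < 6 * n ->
  let t := block_start n a + r in
  [/\ (t < 5 * (n * n)) = false,
      (t - 5 * (n * n)) %/ (6 * n) = a & (t - 5 * (n * n)) %% (6 * n) = r].
Proof.
move=> lt t; have -> : t - 5 * (n * n) = a * (6 * n) + r.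
  by rewrite /t /block_start; lia.
rewrite !divmod2 //; split=> //; rewrite /t /block_start; lia.
Qed.

Lemma decode_gate n a g c :
  a < n -> g < 4 -> c < n ->
  let x := (c + a) %% n in
  decodes n (block_start n a + (g * n + c)) (3 + g + g %/ 2)
    (if odd g then x else c) (if odd g then c else x) (a * n + c) false.
Proof.
move=> an g4 cn x; have rn : g * n + c < 4 * n by nia.
have rn6 : g * n + c < 6 * n by lia.
have [st bE rE] := decode_block a rn6.
have xn : x < n by rewrite ltn_mod; lia.
have sx : unshift n x c = a by apply: unshiftK.
rewrite /decodes /layer_code /source_code /target_code /free_code /probe_code
  /expiry_code /ite_code /static_code /gate_code /gate_kind_code /gated_code
  /shift_code /block_code /offset_code /= st bE rE rn !iteF !iteT !divmod2 //.
have -> : gated_code id eval_binop n (block_start n a + (g * n + c)) = c.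
  by rewrite /gated_code /offset_code /= rE divmod2.
rewrite !modn2 -/x.
by case: g g4 {rn rn6 st bE rE} => [|[|[|[|]]]] //= _;
  rewrite ?iteT ?iteF sx; do !split.
Qed.

Lemma decode_point n a b p :
  a < n -> b < n -> p < 2 ->
  decodes n (point_start n a b + p) (1 + 8 * p)
    (if p == 0 then a else b) (if p == 0 then b else a) (a * n + b) false.
Proof.
move=> an bn p2; have rn : 4 * n + (b * 2 + p) < 6 * n by lia.
have -> : point_start n a b + p = block_start n a + (4 * n + (b * 2 + p)).
  by rewrite /point_start; lia.
have [st bE rE] := decode_block a rn.
have ng : (4 * n + (b * 2 + p) < 4 * n) = false by lia.
rewrite /decodes /layer_code /source_code /target_code /free_code /probe_code
  /expiry_code /ite_code /static_code /gate_code /point_code /point_kind_code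
  /block_code /offset_code /= st bE rE ng !iteF addKn !divmod2 //.
by case: p p2 {rn st bE rE ng} => [|[|]] //= _;
  rewrite ?mul1n ?mul0n ?addn0 ?add0n /point_start; do !split; lia.
Qed.

(** Here a gate is given by its two ends. [shiftK] writes the end in X or Y as the other end plus
    the block modulo [n], the form in which [decode_gate] produces it. *)
Lemma decode_stamp n i x y :
  i < 11 -> x < n -> y < n ->
  exists p fr, decodes n (stamp n i x y) i x y p fr /\
    forall adj, usable n adj i x y = fr || (0 < adj p).
Proof.
move=> i11 xn yn.
have uxy := @unshift_lt n y x yn; have uyx := @unshift_lt n x y xn.
have Exy := shiftK yn xn; have Eyx := shiftK xn yn.
do 11?[case: i i11 => [_|i i11]]; rewrite // /stamp; do 2!eexists.
- by split; [have := @decode_static n 0 x y isT xn yn; rewrite mul0n; exact|].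
- by split; [have := @decode_point n x y 0 xn yn isT; rewrite addn0; exact|].
- by split; [exact: (@decode_static n 1 x y isT xn yn)|].
- by split; [have := @decode_gate n _ 0 x uxy isT xn; rewrite /= Exy; exact|].
- by split; [have := @decode_gate n _ 1 y uyx isT yn; rewrite /= Eyx; exact|].
- by split; [exact: (@decode_static n 2 x y isT xn yn)|].
- by split; [have := @decode_gate n _ 2 x uxy isT xn; rewrite /= Exy; exact|].
- by split; [have := @decode_gate n _ 3 y uyx isT yn; rewrite /= Eyx; exact|].
- by split; [exact: (@decode_static n 3 x y isT xn yn)|].
- by split; [have := @decode_point n y x 1 yn xn isT; rewrite addn1; exact|].
- by split; [exact: (@decode_static n 4 x y isT xn yn)|].
Qed.

Lemma stamp_surj n t :
  t < 11 * (n * n) -> exists i x y, [/\ i < 11, x < n, y < n & stamp n i x y = t].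
Proof.
case/slotP=> [k x y k5 xn yn|a g c an g4 cn|a b p an bn p2].
- case: k k5 => [|[|[|[|[|]]]]] //= _;
    [exists 0|exists 2|exists 5|exists 8|exists 10]; exists x, y; split=> //.
- have xn : (c + a) %% n < n by rewrite ltn_mod; lia.
  have E := unshiftK cn an; case: g g4 => [|[|[|[|]]]] //= _;
    [exists 3, c|exists 4|exists 6, c|exists 7]; exists ((c + a) %% n);
    try (exists c); by rewrite /= E.
- case: p p2 => [|[|]] //= _; [exists 1, a, b|exists 9, b, a]; split=> //=.
    by rewrite addn0.
  by rewrite addn1.
Qed.

Lemma block_lt n a r :
  a < n -> r < 6 * n -> block_start n a + r < 11 * (n * n).
Proof.
move=> an rn; have : a.+1 * (6 * n) <= n * (6 * n) by rewrite leq_mul2r an orbT.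
by rewrite /block_start; lia.
Qed.

Lemma point_lt n a b : a < n -> b < n -> (point_start n a b).+1 < 11 * (n * n).
Proof.
move=> an bn; have := @block_lt n a (4 * n + b * 2).+1 an.
by rewrite addnS; apply; lia.
Qed.

Lemma tail_stamp n i x y :
  i < 11 -> x < n -> y < n -> at_nat tail_code n (stamp n i x y) = i * n + x.
Proof.
move=> i11 xn yn; have [p [fr [[iE xE _ _] _]]] := decode_stamp i11 xn yn.
by rewrite /tail_code iE xE.
Qed.

Lemma head_stamp n i x y :
  i < 11 -> x < n -> y < n -> at_nat head_code n (stamp n i x y) = i.+1 * n + y.
Proof.
move=> i11 xn yn; have [p [fr [[iE _ yE _] _]]] := decode_stamp i11 xn yn.
by rewrite /head_code iE yE /= addn1.
Qed.

Definition weight_at (n : nat) (adj : nat -> nat) (t : nat) : nat :=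
  at_nat weight_code n t (adj (at_nat probe_code n t)).

Lemma weight_stamp n adj i x y :
  i < 11 -> x < n -> y < n ->
  weight_at n adj (stamp n i x y) = slot_weight n adj i x y.
Proof.
move=> i11 xn yn.
have [p [fr [[_ _ _ [frE pE eE]] uE]]] := decode_stamp i11 xn yn.
rewrite /weight_at /weight_code eE /slot_weight uE /=.
case: fr frE pE {uE} => [frE _|frE /(_ isT) ->] /=.
  by rewrite addn_gt0 frE mul1n; lia.
move/negbT: frE; rewrite -eqn0Ngt => /eqP ->.
by rewrite add0n; case: ltnP => _; rewrite ?mul1n ?mul0n //; lia.
Qed.

(** * The graphs *)

Definition slot_graph (n : nat) (adj : nat -> nat) (m u v : nat) : nat :=
  let i := u %/ n in let x := u %% n in let y := v %% n in
  if [&& i < 11, v %/ n == i.+1 & stamp n i x y < m]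
  then slot_weight n adj i x y else 0.

Lemma slot_graphE n adj m i x y :
  i < 11 -> x < n -> y < n ->
  slot_graph n adj m (i * n + x) (i.+1 * n + y) =
  if stamp n i x y < m then slot_weight n adj i x y else 0.
Proof. by move=> i11 xn yn; rewrite /slot_graph !divmod2 // i11 eqxx. Qed.

Lemma slot_graph_arc n adj m u v :
  0 < n -> slot_graph n adj m u v != 0 ->
  exists i x y, [/\ i < 11, x < n, y < n
    & [/\ u = i * n + x, v = i.+1 * n + y & stamp n i x y < m]].
Proof.
move=> n0; rewrite /slot_graph; case: ifP => // /and3P[i11 /eqP vE lt] _.
exists (u %/ n), (u %% n), (v %% n); rewrite !ltn_mod; split=> //; split=> //.
  exact: divn_eq.
by rewrite -vE; apply: divn_eq.
Qed.

Lemma slot_graph0 n adj u v : slot_graph n adj 0 u v = 0.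
Proof. by rewrite /slot_graph ltn0 !andbF. Qed.

(** Every insertion thus meets an absent arc, and every deletion of the reversed sequence restores
    the earlier graph. *)
Lemma slot_graph_fresh n adj t :
  t < 11 * (n * n) ->
  slot_graph n adj t (at_nat tail_code n t) (at_nat head_code n t) = 0.
Proof.
move=> /stamp_surj[i [x [y [i11 xn yn <-]]]].
by rewrite tail_stamp // head_stamp // slot_graphE // ltnn.
Qed.

Lemma slot_graphS n adj t u v :
  t < 11 * (n * n) ->
  slot_graph n adj t.+1 u v =
  if (u == at_nat tail_code n t) && (v == at_nat head_code n t)
  then weight_at n adj t else slot_graph n adj t u v.
Proof.
move=> lt; have n0 : 0 < n by move: lt; case: (n) => //; rewrite !muln0.
case: (stamp_surj lt) => i [x [y [i11 xn yn tE]]].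
rewrite -tE tail_stamp // head_stamp // weight_stamp //.
case: ifP => [/andP[/eqP-> /eqP->]|ne]; first by rewrite slot_graphE // ltnSn.
rewrite /slot_graph; case: (ltnP (u %/ n) 11) => //= j11.
case: eqP => //= vE; rewrite ltnS leq_eqVlt; case: eqP => //= E.
have xn' : u %% n < n by rewrite ltn_mod.
have yn' : v %% n < n by rewrite ltn_mod.
(* Injectivity of [stamp]: equal stamps decode to the same tail and the same head. *)
have := tail_stamp j11 xn' yn'; have := head_stamp j11 xn' yn'.
rewrite E tail_stamp // head_stamp // -vE -!divn_eq => E1 E2.
by move: ne; rewrite E1 E2 !eqxx.
Qed.

Lemma weight_at_gt0 n adj t : 0 < weight_at n adj t.
Proof. by rewrite /weight_at /weight_code /= add1n. Qed.

Lemma slot_weight_le n adj i x y :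
  i < 11 -> x < n -> y < n -> slot_weight n adj i x y <= 11 * (n * n) + 2.
Proof.
move=> i11 xn yn.
have uxy := @unshift_lt n y x yn; have uyx := @unshift_lt n x y xn.
rewrite /slot_weight; case: usable; last by lia.
suff : expiry n i x y <= 11 * (n * n) by lia.
have p1 := point_lt xn yn; have p2 := point_lt yn xn.
by do 11?[case: i i11 => [_|i i11]]; rewrite /expiry // ltnW // block_lt //; lia.
Qed.

Lemma weight_at_le n adj t :
  t < 11 * (n * n) -> weight_at n adj t <= 11 * (n * n) + 2.
Proof.
move=> /stamp_surj[i [x [y [i11 xn yn <-]]]].
by rewrite weight_stamp // slot_weight_le.
Qed.

(** * Adjacency words, 4-cliques and path widths *)

Lemma matrix_wordE n (M : 'I_n -> 'I_n -> nat) (u v : 'I_n) :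
  matrix_word M (u * n + v) = M u v.
Proof. by rewrite /matrix_word !divmod2 ?ltn_ord // !valK. Qed.

Definition adjacency (n : nat) (e : rel 'I_n) : nat -> nat :=
  matrix_word (fun u v => nat_of_bool (e u v)).

Lemma adjacencyE n (e : rel 'I_n) (u v : 'I_n) :
  adjacency e (u * n + v) = e u v.
Proof. exact: matrix_wordE. Qed.

Lemma adjacency_le1 n (e : rel 'I_n) i : adjacency e i <= 1.
Proof.
rewrite /adjacency /matrix_word.
by case: insub => // u; case: insub => // v; apply: leq_b1.
Qed.

Lemma clique4P (T : finType) (e : rel T) :
  symmetric e -> irreflexive e ->
  has_clique4 e <->
  exists a b c d, [/\ e a b, e b c, e a c & [/\ e c d, e a d & e b d]].
Proof.
move=> sy ir; split=> [[Q [Q4 clQ]]|[a [b [c [d [ab bc ac [cd ad bd]]]]]]].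
  have : size (enum Q) = 4 by rewrite -cardE.
  have mQ x : x \in enum Q -> x \in Q by rewrite mem_enum.
  have := enum_uniq (mem Q).
  case: (enum Q) mQ => [|a [|b [|c [|d [|? ?]]]]] //= mQ.
  rewrite !inE !negb_or => /and4P[/and3P[ab ac ad] /andP[bc bd] cd _] _.
  have [Qa Qb Qc Qd] : [/\ a \in Q, b \in Q, c \in Q & d \in Q].
    by split; apply: mQ; rewrite !inE eqxx ?orbT.
  by exists a, b, c, d; split=> //; try split=> //; apply: clQ.
have ne x y : e x y -> x != y by move=> exy; apply/eqP => E; rewrite E ir in exy.
exists [set x in [:: a; b; c; d]]; split.
  rewrite cardsE; apply/card_uniqP.
  by rewrite /= !inE !negb_or !(ne _ _ ab, ne _ _ ac, ne _ _ ad, ne _ _ bc,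
    ne _ _ bd, ne _ _ cd).
move=> x y; rewrite !inE.
by case/or4P=> /eqP->; case/or4P=> /eqP->; rewrite ?eqxx // => _; rewrite // sy.
Qed.

Lemma gt_foldr_minn m z l :
  (m < foldr minn z l) = (m < z) && all (fun w => m < w) l.
Proof.
elim: l => [|w l IH] /=; first by rewrite andbT.
by rewrite leq_min IH andbCA.
Qed.

(** The initial value of the fold is the weight of the first arc, which is also the first entry of
    the list, so it adds no condition. *)
Lemma gt_path_width n (G : wdigraph n) s v p m :
  (m < path_width G s (v :: p)) = path (fun u w => m < G u w) s (v :: p).
Proof.
rewrite /path_width gt_foldr_minn.
have -> : forall q u, all (fun w => m < w) (pairmap G u q)
    = path (fun u w => m < G u w) u q by elim=> //= w q IH u; rewrite IH.
by rewrite /= andbA andbb.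
Qed.

(** * What being alive at a common moment forces on arcs *)

Lemma unshift_inj n x c c' :
  x < n -> c < n -> c' < n -> unshift n x c = unshift n x c' -> c = c'.
Proof.
move=> xn cn cn'; rewrite /unshift !modn_once; try lia.
by case: (ltnP (x + n - c) n); case: (ltnP (x + n - c') n); lia.
Qed.

(** The two ranges are the lifetimes of the arcs [a -> b] and [b' -> a']. With P and P' their point
    starts, the second gives m = P' + 2 and the first then P = P' or P = P' + 1; starts of points
    all have the same parity, so P = P'. *)
Lemma point_start_inj n m a b a' b' :
  b < n -> b' < n ->
  point_start n a b < m < (point_start n a b).+3 ->
  (point_start n a' b').+1 < m < (point_start n a' b').+3 ->
  [/\ a = a', b = b' & m = (point_start n a b).+2].
Proof.
move=> bn bn' r1 r2.
have E : a * (6 * n) + b * 2 = a' * (6 * n) + b' * 2.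
  have : a * (6 * n) = (a * (3 * n)) * 2 by lia.
  have : a' * (6 * n) = (a' * (3 * n)) * 2 by lia.
  by move: r1 r2; rewrite /point_start /block_start; lia.
have [q1 r1'] := @divmod2 a (b * 2) (6 * n) ltac:(lia).
have [q2 r2'] := @divmod2 a' (b' * 2) (6 * n) ltac:(lia).
have Ea : a = a' by rewrite -q1 E q2.
have Eb : b = b' by move: r1'; rewrite E r2'; lia.
by split=> //; move: r1 r2; rewrite Ea Eb; lia.
Qed.

(** Offsets range over 1, ..., [6 * n] and not from 0, because a moment counts insertions already
    made: the pair with [b = n - 1] is tested at offset exactly [6 * n]. *)
Lemma block_start_inj n a r a' r' :
  r <= 6 * n -> r' <= 6 * n -> 0 < r -> 0 < r' ->
  block_start n a + r = block_start n a' + r' -> a = a'.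
Proof.
rewrite /block_start => rn rn' r0 r0' E; case: (ltngtP a a') => // lt.
  by have := leq_mul lt (leqnn (6 * n)); lia.
by have := leq_mul lt (leqnn (6 * n)); lia.
Qed.

Lemma block_of_point n m a b a' r :
  b < n -> m = (point_start n a b).+2 ->
  block_start n a' + r < m < (block_start n a' + (6 * n - 1)).+2 -> a' = a.
Proof.
move=> bn mE rm.
apply: (@block_start_inj n a' (m - block_start n a') a (4 * n + b * 2 + 2));
  move: rm; rewrite mE /point_start; lia.
Qed.

(** * Wide s-t paths correspond to 4-cliques *)

Section Core.
Variables (n : nat) (e : rel 'I_n).
Hypotheses (sym_e : symmetric e) (irr_e : irreflexive e).

Definition graph_at (m : nat) : wdigraph (12 * n) :=
  fun u v => slot_graph n (adjacency e) m u v.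

Variables s t : 'I_(12 * n).
Hypotheses (s0 : val s = 0) (t11 : val t = 11 * n).

Let n0 : 0 < n.
Proof. by have := leq_ltn_trans (leq0n s) (ltn_ord s); rewrite muln_gt0. Qed.

Definition alive (m i x y : nat) : Prop :=
  [/\ y < n, stamp n i x y < m, usable n (adjacency e) i x y
    & m < (expiry n i x y).+2].

(** Arcs join consecutive layers, so a path from layer [i < 11] to [t] cannot be empty and its next
    vertex lies in layer [i.+1]. *)
Lemma alive_step m i x (u : 'I_(12 * n)) p :
  i < 11 -> x < n -> val u = i * n + x ->
  path (fun u w => m < graph_at m u w) u p -> val (last u p) = 11 * n ->
  exists (v : 'I_(12 * n)) q y, [/\ alive m i x y, val v = i.+1 * n + y,
    path (fun u w => m < graph_at m u w) v q & val (last v q) = 11 * n].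
Proof.
move=> i11 xn uE; case: p => [_ E|v q /= /andP[lt pq lq]].
  have Ei : 11 * n = i * n + x := etrans (esym E) uE.
  by have := leq_mul i11 (leqnn n); lia.
have nz : slot_graph n (adjacency e) m u v != 0 by rewrite -lt0n; apply: leq_ltn_trans lt.
have [j [x' [y [j11 xn' yn [Eu Ev lt']]]]] := slot_graph_arc n0 nz.
have E : j * n + x' = i * n + x by rewrite -uE -Eu.
have Ei : j = i by rewrite -(divmod2 j xn').1 E divmod2.
have Ex : x' = x by rewrite -(divmod2 j xn').2 E divmod2.
subst j x'; exists v, q, y; split=> //; split=> //.
(* The inserted arc has [stamp < m], so [m] is positive and the weight 1 of an unusable arc does not
   exceed it. *)
all: move: lt; rewrite /graph_at Eu Ev slot_graphE // lt' /slot_weight.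
  by case: usable => //; lia.
by case: usable => //; lia.
Qed.

Lemma graph_sound m b :
  is_bottleneck (graph_at m) s t b -> m < b -> has_clique4 e.
Proof.
move=> [_ [[p /and3P[_ /eqP lp _] wE]|[_ ->]]] // ltm.
have {wE ltm} pw : path (fun u w => m < graph_at m u w) s p.
  case: p lp wE => [lp|v p _ wE]; last by rewrite -gt_path_width wE.
  by have := congr1 val lp; rewrite /= s0 t11; lia.
have {}lp : val (last s p) = 11 * n by rewrite lp.
(* The path is read off layer by layer as [a1, b1, c1, x, c2, d1, y, d2, b2, a2]; index 2 stands for
   the primed layers. *)
have [v1 [p1 [a1 [[a1n _ _ _] E1 P1 L1]]]] := alive_step (isT : 0 < 11) n0 s0 pw lp.
have [v2 [p2 [b1 [[b1n l1 u1 r1] E2 P2 L2]]]] := alive_step (isT : 1 < 11) a1n E1 P1 L1.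
have [v3 [p3 [c1 [[c1n l2 u2 r2] E3 P3 L3]]]] := alive_step (isT : 2 < 11) b1n E2 P2 L2.
have [v4 [p4 [x [[xn l3 u3 r3] E4 P4 L4]]]] := alive_step (isT : 3 < 11) c1n E3 P3 L3.
have [v5 [p5 [c2 [[c2n l4 u4 r4] E5 P5 L5]]]] := alive_step (isT : 4 < 11) xn E4 P4 L4.
have [v6 [p6 [d1 [[d1n l5 u5 r5] E6 P6 L6]]]] := alive_step (isT : 5 < 11) c2n E5 P5 L5.
have [v7 [p7 [y [[yn l6 u6 r6] E7 P7 L7]]]] := alive_step (isT : 6 < 11) d1n E6 P6 L6.
have [v8 [p8 [d2 [[d2n l7 u7 r7] E8 P8 L8]]]] := alive_step (isT : 7 < 11) yn E7 P7 L7.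
have [v9 [p9 [b2 [[b2n l8 u8 r8] E9 P9 L9]]]] := alive_step (isT : 8 < 11) d2n E8 P8 L8.
have [v10 [p10 [a2 [[a2n l9 u9 r9] _ _ _]]]] := alive_step (isT : 9 < 11) b2n E9 P9 L9.
move: l1 r1 l9 r9 => /= l1 r1 l9 r9.
(* The two point arcs determine [m], and [m] lies in the block of [a1]; therefore all four gates on
   the path belong to that block. *)
have [Ea Eb mE] : [/\ a1 = a2, b1 = b2 & m = (point_start n a1 b1).+2].
  by apply: point_start_inj => //; rewrite ?l1 ?l9.
subst a2 b2; move: l3 r3 l4 r4 l6 r6 l7 r7 => /= l3 r3 l4 r4 l6 r6 l7 r7.
have a3 : unshift n x c1 = a1.
  by apply: (block_of_point b1n mE (r := 0 * n + c1)); rewrite l3.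
have a4 : unshift n x c2 = a1.
  by apply: (block_of_point b1n mE (r := 1 * n + c2)); rewrite l4.
have a6 : unshift n y d1 = a1.
  by apply: (block_of_point b1n mE (r := 2 * n + d1)); rewrite l6.
have a7 : unshift n y d2 = a1.
  by apply: (block_of_point b1n mE (r := 3 * n + d2)); rewrite l7.
have cc : c1 = c2 by apply: (@unshift_inj n x); rewrite ?a3.
have dd : d1 = d2 by apply: (@unshift_inj n y); rewrite ?a6.
subst c2 d2; move: u1 u2 u3 u5 u6 u8; rewrite /= a3 a6.
have adj x' y' (xn' : x' < n) (yn' : y' < n) :
    0 < adjacency e (x' * n + y') -> e (Ordinal xn') (Ordinal yn').
  by rewrite -[x']/(val (Ordinal xn')) -[y']/(val (Ordinal yn')) adjacencyE lt0b.
move=> /(adj _ _ a1n b1n) ab /(adj _ _ b1n c1n) bc /(adj _ _ a1n c1n) ac.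
move=> /(adj _ _ c1n d1n) cd /(adj _ _ a1n d1n) ad /(adj _ _ d1n b1n) db.
apply/(clique4P sym_e irr_e).
exists (Ordinal a1n), (Ordinal b1n), (Ordinal c1n), (Ordinal d1n).
by split=> //; split=> //; rewrite sym_e.
Qed.

Definition node (i x : nat) : 'I_(12 * n) := insubd s (i * n + x).

Lemma val_node i x : i < 12 -> x < n -> val (node i x) = i * n + x.
Proof.
move=> i12 xn; rewrite val_insubd; case: ifP => //.
by have := leq_mul i12 (leqnn n); lia.
Qed.

(** The moment is the one just after both point arcs of the pair have been inserted. Both bounds on
    it are strict because answers are given after updates only: at levels 1, ..., 11 n^2 when
    inserting and 0, ..., 11 n^2 - 1 when deleting. *)
Lemma graph_complete :
  has_clique4 e -> exists m, [/\ 0 < m, m < 11 * (n * n) &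
    forall b, is_bottleneck (graph_at m) s t b -> m < b].
Proof.
case/(clique4P sym_e irr_e)=> a [b [c [d [ab bc ac [cd ad bd]]]]].
have [an bn cn dn] := And4 (ltn_ord a) (ltn_ord b) (ltn_ord c) (ltn_ord d).
set m := (point_start n a b).+2; exists m.
pose x := (c + a) %% n; pose y := (d + a) %% n.
have xn : x < n by rewrite ltn_mod.
have yn : y < n by rewrite ltn_mod.
have sx : unshift n x c = a by apply: unshiftK.
have sy : unshift n y d = a by apply: unshiftK.
have mT : m < 11 * (n * n).
  (* The case [a = b = n - 1], which would give m = 11 n^2, is excluded by irreflexivity. *)
  have ne : (a : nat) != b by apply/eqP => /val_inj E; rewrite E irr_e in ab.
  have : a.+1 * (6 * n) <= n * (6 * n) by rewrite leq_mul2r an orbT.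
  rewrite /m /point_start /block_start.
  case: (leqP a.+2 n) => [le|gt]; last by move: ne; lia.
  have : a.+2 * (6 * n) <= n * (6 * n) by rewrite leq_mul2r le orbT.
  lia.
split=> // w [wmax _].
pose l := [:: node 1 a; node 2 b; node 3 c; node 4 x; node 5 c; node 6 d;
  node 7 y; node 8 d; node 9 b; node 10 a; node 11 0].
have sE : s = node 0 0 by apply: val_inj; rewrite val_node //= s0.
have step i x' y' : i < 11 -> x' < n -> y' < n -> stamp n i x' y' < m ->
    usable n (adjacency e) i x' y' -> m < (expiry n i x' y').+2 ->
    m < graph_at m (node i x') (node i.+1 y').
  move=> i11 xn' yn' lt us gt; rewrite /graph_at !val_node //; last by lia.
  by rewrite slot_graphE // lt /slot_weight us.
have pw : path (fun u w => m < graph_at m u w) s l.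
  have stat k r : k < 5 -> r < n * n -> k * (n * n) + r < m.
    move=> k5 rn; have := leq_mul (k5 : k <= 4) (leqnn (n * n)).
    by rewrite /m /point_start /block_start; lia.
  have small x' y' : x' < n -> y' < n -> x' * n + y' < n * n by nia.
  have gate g c' : g < 4 -> c' < n -> block_start n a + (g * n + c') < m.
    move=> g4 cn'; have := leq_mul (g4 : g <= 3) (leqnn n).
    by rewrite /m /point_start; lia.
  have bend : m < (block_start n a + (6 * n - 1)).+2.
    by rewrite /m /point_start; lia.
  have adj (u v : 'I_n) : 0 < adjacency e (u * n + v) = e u v.
    by rewrite adjacencyE lt0b.
  have first_point : point_start n a b < m by rewrite /m; lia.
  have last_point : (point_start n a b).+1 < m by rewrite /m.
  have first_expiry : m < (point_start n a b).+3 by rewrite /m.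
  have last_expiry : m < (point_start n a b).+3 by rewrite /m.
  have static_expiry : m < (11 * (n * n)).+2 by lia.
  move: (m) (step) (stat) (gate) (bend) first_point last_point first_expiry
    last_expiry static_expiry {mT wmax} => {}m {}step {}stat {}gate {}bend p1 p9 q1 q9 q.
  rewrite sE /l /=; repeat (apply/andP; split) => //; apply: step => //;
    rewrite /stamp /usable /expiry ?sx ?sy ?adj ?(sym_e d) //.
  - exact: (stat 0 _ isT (small _ _ n0 an)).
  - exact: (stat 1 _ isT (small _ _ bn cn)).
  - exact: (gate 0 _ isT cn).
  - exact: (gate 1 _ isT cn).
  - exact: (stat 2 _ isT (small _ _ cn dn)).
  - exact: (gate 2 _ isT dn).
  - exact: (gate 3 _ isT dn).
  - exact: (stat 3 _ isT (small _ _ dn bn)).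
  - exact: (stat 4 _ isT (small _ _ an n0)).
have st_l : st_path (graph_at m) s t l.
  apply/and3P; split.
  - apply: sub_path pw => u v; rewrite /arc -lt0n; exact: leq_ltn_trans.
  - by apply/eqP/val_inj; rewrite /= val_node //= addn0.
  (* The vertices are distinct since their layers are. *)
  - apply: (@map_uniq _ _ (fun u : 'I_(12 * n) => u %/ n)).
    by rewrite sE /= !val_node // !divmod2.
by apply: leq_trans (wmax _ st_l); rewrite gt_path_width.
Qed.

End Core.

(** * The sequence of updates *)

(* When the counter is k, the current graph consists of the first
   [level K n k] slots. *)
Definition level (K : setting) (n k : nat) : nat :=
  if K is Incremental then 11 * (n * n) - k else k.

(* The slot handled while the counter goes from k.+1 to k. *)
Definition position (K : setting) (n k : nat) : nat :=
  if K is Incremental then 11 * (n * n) - k.+1 else k.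

Section Updates.
Variables (K : setting) (n : nat) (e : rel 'I_n) (s : 'I_(12 * n)).

Let T := 11 * (n * n).
Let adj := adjacency e.

Definition slot_update (k : nat) : update (12 * n) :=
  (insubd s (at_nat tail_code n (position K n k)),
   insubd s (at_nat head_code n (position K n k)),
   if K is Incremental then weight_at n adj (position K n k) else 0).

Fixpoint slot_updates (k : nat) : seq (update (12 * n)) :=
  if k is k'.+1 then slot_update k' :: slot_updates k' else [::].

Definition graph_of (k : nat) : wdigraph (12 * n) := graph_at e (level K n k).

Lemma position_lt k : k < T -> position K n k < T.
Proof. by rewrite /T /position; case: K => //; lia. Qed.

Lemma tail_head_lt t :
  t < T -> at_nat tail_code n t < at_nat head_code n t < 12 * n.
Proof.
move=> /stamp_surj[i [x [y [i11 xn yn <-]]]].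
rewrite tail_stamp // head_stamp //.
by have := leq_mul i11 (leqnn n); lia.
Qed.

Lemma val_tail k : k < T ->
  val (slot_update k).1.1 = at_nat tail_code n (position K n k).
Proof.
move=> /position_lt/tail_head_lt/andP[lt1 lt2].
by rewrite val_insubd (ltn_trans lt1 lt2).
Qed.

Lemma val_head k : k < T ->
  val (slot_update k).1.2 = at_nat head_code n (position K n k).
Proof. by move=> /position_lt/tail_head_lt/andP[_ lt2]; rewrite val_insubd lt2. Qed.

Lemma apply_slot_update k :
  (* An equality of functions and not only of values, because [serves] is indexed by the current
     graph. *)
  k < T -> apply_update (graph_of k.+1) (slot_update k) = graph_of k.
Proof.
move=> kT; apply: functional_extensionality => u.
apply: functional_extensionality => v; rewrite /apply_update.
rewrite -(inj_eq val_inj u) -(inj_eq val_inj v) val_tail // val_head //.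
rewrite /graph_of /graph_at /level /slot_update /position; case: K => /=.
  have -> : 11 * (n * n) - k = (11 * (n * n) - k.+1).+1 by rewrite /T in kT; lia.
  by rewrite slot_graphS //; rewrite /T in kT; lia.
rewrite slot_graphS; last exact: kT.
case: ifP => [/andP[/eqP uE /eqP vE]|->] //.
by rewrite uE vE slot_graph_fresh.
Qed.

Lemma slot_update_valid k : k < T ->
  valid_update K ((12 * n) ^ 2) (graph_of k.+1) (slot_update k).
Proof.
move=> kT; have pT := position_lt kT.
have n0 : 0 < n by move: kT; rewrite /T; case: (n) => //; rewrite !muln0.
have vt := val_tail kT; have vh := val_head kT.
have := tail_head_lt pT; rewrite -vt -vh => /andP[lt _].
rewrite /valid_update; case E: K.
  have wle : weight_at n adj (position K n k) <= 11 * (n * n) + 2 by apply: weight_at_le.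
  have wE : (slot_update k).2 = weight_at n adj (position K n k).
    by rewrite /slot_update E.
  have gE : level K n k.+1 = position K n k by rewrite /level /position E.
  apply/and3P; split.
  - by apply: contraTneq lt => ->; rewrite ltnn.
  - by rewrite /arc negbK /graph_of /graph_at vt vh gE slot_graph_fresh.
  (* Weights are at most 11 n^2 + 2, which is below (12 n)^2. *)
  - by rewrite wE weight_at_gt0 /=; apply: leq_trans wle _; rewrite expnS expn1; nia.
have gE : level K n k.+1 = (position K n k).+1 by rewrite /level /position E.
have -> : (slot_update k).2 = 0 by rewrite /slot_update E.
rewrite eqxx andbT /arc /graph_of /graph_at vt vh gE.
by rewrite slot_graphS // !eqxx -lt0n weight_at_gt0.
Qed.

Lemma slot_updates_valid k : k <= T ->
  valid_updates K ((12 * n) ^ 2) (graph_of k) (slot_updates k).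
Proof.
elim: k => //= k IH kT; rewrite slot_update_valid //= apply_slot_update //.
exact: IH (ltnW kT).
Qed.

Lemma slot_start_valid : 0 < n -> valid_start K ((12 * n) ^ 2) (graph_of T).
Proof.
move=> n0; rewrite /graph_of /level /valid_start; case: K => [u v|u v].
  by rewrite subnn /graph_at slot_graph0.
have [z|nz] := eqVneq (graph_at e T u v) 0; first by rewrite z.
have [i [x [y [i11 xn yn [Eu Ev lt]]]]] := slot_graph_arc n0 nz.
split=> [|E].
  rewrite /graph_at Eu Ev slot_graphE // lt.
  apply: leq_trans (slot_weight_le _ i11 xn yn) _; rewrite expnS expn1; nia.
have := divmod2 i.+1 yn; have := divmod2 i xn.
by rewrite -Eu -Ev E => -[-> _] [Ei]; lia.
Qed.

End Updates.

(** * The program *)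

Definition num_vertices : expr := EReg 0.
Definition slot_reg : expr := EReg 6.

Definition tail_expr := tail_code EConst EOp num_vertices slot_reg.
Definition head_expr := head_code EConst EOp num_vertices slot_reg.
Definition weight_expr :=
  weight_code EConst EOp num_vertices slot_reg
    (ELoad 0 (probe_code EConst EOp num_vertices slot_reg)).

Definition elapsed_expr : expr :=
  EOp Sub (EOp Mul (EConst 11) (EOp Mul num_vertices num_vertices)) (EReg 2).
Definition position_expr (K : setting) : expr :=
  if K is Incremental then elapsed_expr else EOp Sub (EReg 2) (EConst 1).
Definition level_expr (K : setting) : expr :=
  if K is Incremental then EOp Add slot_reg (EConst 1) else slot_reg.
Definition arg_expr (K : setting) : expr :=
  if K is Incremental then weight_expr else EConst 0.
Definition scaled_expr (k : nat) : expr := EOp Mul (EConst k) num_vertices.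
Definition cell_expr : expr :=
  EOp Add (EOp Mul tail_expr (scaled_expr 12)) head_expr.
(** The disjunction of two flags: register 4 remembers success in earlier rounds, register 10 is the
    outcome of the present one. *)
Definition found_expr : expr := EOp Lt (EConst 0) (EOp Add (EReg 4) (EReg 10)).

Definition call (c : cmd) : cmd := CLib (rename odd_name c).

(* In the decremental setting this fills the matrix of the initial graph,
   which is array 0 of the library, alias array 1. *)
Definition fill_step (K : setting) : cmd :=
  if K is Incremental then CSkip else
  CSeq (assign 6 elapsed_expr)
 (CSeq (assign 8 cell_expr)
 (CSeq (assign 10 weight_expr)
       (CStore 1 8 10))).

(** Registers 1, 3, 5 are the argument registers 0, 1, 2 of the library, and its answer returns in
    register 1. The comparison tests whether the bottleneck exceeds the number of slots present,
    kept in register 8. *)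
Definition main_step (K : setting) (A : dyn_alg) : cmd :=
  CSeq (assign 6 (position_expr K))
 (CSeq (assign 8 (level_expr K))
 (CSeq (assign 1 tail_expr)
 (CSeq (assign 3 head_expr)
 (CSeq (assign 5 (arg_expr K))
 (CSeq (call (do_update A))
 (CSeq (call (do_query A))
 (CSeq (COp Lt 10 8 1)
       (assign 4 found_expr)))))))).

Definition clique_program (K : setting) (A : dyn_alg) : cmd :=
  CSeq (phase (fill_step K))
 (CSeq (assign 1 (scaled_expr 12))
 (CSeq (assign 3 (EConst 0))
 (CSeq (assign 5 (scaled_expr 11))
 (CSeq (call (do_init A))
 (CSeq (phase (main_step K A))
       (assign 0 (EReg 4))))))).

Lemma library_in_compile L e d : library_in L (compile e d).
Proof. by elim: e d => //= o e IHe f IHf d; split. Qed.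

Lemma program_library K A :
  library_in (procedure_of A) (clique_program K A).
Proof.
have a x e : library_in (procedure_of A) (assign x e).
  by split=> //; apply: library_in_compile.
have c d : procedure_of A (rename odd_name d) ->
    library_in (procedure_of A) (call d) by [].
split; first by split=> //; case: K => //; do !split; apply: a.
do 3!(split; first exact: a); split; first by apply: c; apply: Or31.
split; last exact: a.
do 2!split=> //; do 5!(split; first exact: a).
split; first by apply: c; apply: Or32.
by split; first (by apply: c; apply: Or33); split=> //; apply: a.
Qed.

Lemma program_linear K A : linear_own_time (clique_program K A).
Proof.
pose f := cmd_size (fill_step K); pose g := cmd_size (main_step K A).
pose h := cmd_size (CSeq (assign 1 (scaled_expr 12)) (CSeq (assign 3 (EConst 0))
  (CSeq (assign 5 (scaled_expr 11)) (CSeq (call (do_init A)) (assign 0 (EReg 4)))))).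
(* Two phases of 11 n^2 rounds each, whose set-up and last test cost 4 steps apiece, and the
   straight-line rest [h]. *)
exists (11 * (f + 4) + 11 * (g + 4) + 8 + h) => B n e own lib s' ex.
inversion_clear ex as [| | | | |? ? ? s1 ? o1 l1 o1' l1' x1 y1| | | | |].
inversion_clear y1 as [| | | | |? ? ? s2 ? o2 l2 o2' l2' x2 y2| | | | |].
inversion_clear y2 as [| | | | |? ? ? s3 ? o3 l3 o3' l3' x3 y3| | | | |].
inversion_clear y3 as [| | | | |? ? ? s4 ? o4 l4 o4' l4' x4 y4| | | | |].
inversion_clear y4 as [| | | | |? ? ? s5 ? o5 l5 o5' l5' x5 y5| | | | |].
inversion_clear y5 as [| | | | |? ? ? s6 ? o6 l6 o6' l6' x6 y6| | | | |].
have lf : loopfree (fill_step K) by case: (K).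
have nf x : x \in [:: 0; 2] -> ~~ writes x (fill_step K).
  case: (K) => // x02; rewrite /fill_step /= -!/(assign _ _).
  by move: x02; rewrite !inE => /orP[] /eqP->; vm_compute.
have lg : loopfree (main_step K A) by rewrite /main_step /= !compile_loopfree.
have ng : ~~ writes 2 (main_step K A).
  rewrite /main_step ![writes _ (CSeq _ _)]/= !writes_rename //.
  by case: (K); vm_compute.
have r1 : reg s1 0 = n.
  rewrite (exec_unwritten x1) //.
  by rewrite /phase /= /countdown /= negb_or nf.
have r5 : reg s5 0 = n.
  rewrite (exec_unwritten x5) ?(exec_unwritten x4) ?(exec_unwritten x3)
    ?(exec_unwritten x2) //.
  by rewrite /call /= writes_rename.
have b1 : o1 <= 11 * (n * n) * (f + 4) + 4 := phase_own lf (nf 2 isT) x1.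
have b6 : o6 <= 11 * (n * n) * (g + 4) + 4.
  by have := phase_own lg ng x6; rewrite r5.
have b2 := loopfree_own x2 isT; have b3 := loopfree_own x3 isT.
have b4 := loopfree_own x4 isT; have b5 := loopfree_own x5 isT.
have b7 := loopfree_own y6 isT.
have : o2 + (o3 + (o4 + (o5 + o6'))) <= h.
  by rewrite /h [cmd_size _]/= -!/(cmd_size _); do 4!(apply: leq_add => //).
rewrite -mulnn; move: b1 b6; clearbody f g h; clear.
have -> : 11 * (n * n) * (f + 4) = 11 * (f + 4) * (n * n) by lia.
have -> : 11 * (n * n) * (g + 4) = 11 * (g + 4) * (n * n) by lia.
move: (11 * (f + 4)) (11 * (g + 4)) (n * n) => X Y q.
by have := leq0n (h * q); lia.
Qed.

(** * Correctness of the program *)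

Definition own_regs : pred nat := mem [:: 0; 2; 4; 6; 8; 10].

Lemma hosts_agree_even S m S' x v :
  hosts S m -> ~~ odd x -> agree 20 (set_reg S x v) S' -> hosts S' m.
Proof.
move=> [hr ha] ev [aE rE]; split=> [y|a i]; last by rewrite aE ha.
by rewrite rE /= ?odd_double // eq_sym (negPf (_ : x != odd_name y))
  ?even_neq_odd_name // hr.
Qed.

Lemma hosts_agree_odd S m S' y v :
  hosts S m -> agree 20 (set_reg S (odd_name y) v) S' -> hosts S' (set_reg m y v).
Proof.
move=> [hr ha] [aE rE]; split=> [z|a i]; last by rewrite aE ha.
by rewrite rE /= ?odd_double // odd_name_eq hr.
Qed.

Lemma hosts_ext S m m' :
  hosts S m -> (forall x, reg m x = reg m' x) ->
  (forall a i, arr m a i = arr m' a i) -> hosts S m'.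
Proof. by move=> [hr ha] rE aE; split=> *; rewrite ?hr ?ha. Qed.

Section Run.
Variables (n : nat) (e : rel 'I_n) (B : nat).
Hypothesis n0 : 0 < n.

Let T := 11 * (n * n).
Let M := (n + 2) ^ 10.

Definition inv (S : store) : Prop :=
  [/\ reg S 0 = n, forall i, arr S 0 i = adjacency e i
    & forall x, own_regs x -> reg S x < M].

Lemma M_large : [/\ 11 < M, T + 2 < M & (12 * n) * (12 * n) < M].
Proof.
(* Ten splits as 8 + 2: the quadratic factor absorbs n^2, and 200 exceeds the largest coefficient
   144. *)
have le : 200 <= (n + 2) ^ 8.
  by apply: (@leq_trans (3 ^ 8)) => //; rewrite leq_exp2r //; lia.
have le2 := leq_mul le (leqnn ((n + 2) * (n + 2))).
have E : M = (n + 2) ^ 8 * ((n + 2) * (n + 2)).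
  by rewrite /M (expnD _ 8 2) mulnn.
rewrite E /T.
by split; apply: leq_trans le2; lia.
Qed.

Lemma adjacency_small i : adjacency e i < M.
Proof. by have [+ _ _] := M_large; have := adjacency_le1 e i; lia. Qed.

Lemma runs_assign_inv x ex S :
  inv S -> wf own_regs ex -> (n + 2) ^ edeg 10 ex <= B ->
  x != 0 -> (own_regs x -> eval S ex < M) ->
  runs B (assign x ex) S 0
    (fun S' => agree 20 (set_reg S x (eval S ex)) S' /\ inv S').
Proof.
move=> [r0 a0 sm] we leB x0 lt.
have Mn : 1 < n + 2 by lia.
have small y : own_regs y -> y < 20.
  by rewrite /own_regs /= !inE; lia.
have as_ i : arr S 0 i < M by rewrite a0 adjacency_small.
apply: runs_weaken (runs_assign x Mn small sm as_ we leB) _ => S' ag; split=> //.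
have [aE rE] := ag; split.
- by rewrite rE //= eq_sym (negPf x0).
- by move=> i; rewrite aE /= a0.
- move=> y oy; rewrite rE ?(small _ oy) ?orbT //=.
  by case: eqP => [E|_]; [apply: lt; rewrite -E|apply: sm].
Qed.

Lemma inv_same_even S S' : inv S -> same_even S S' -> inv S'.
Proof.
move=> [r0 a0 sm] [rE aE]; split=> [|i|x ox]; rewrite ?rE ?aE //.
  exact: sm.
by move: ox; rewrite /own_regs /= !inE => /or4P[/eqP->|/eqP->|/eqP->|/or3P[] /eqP->].
Qed.

Lemma inv_set_counter S k :
  inv S -> k < M -> inv (set_reg (set_reg S 20 1) 2 k).
Proof.
move=> [r0 a0 sm] kM; split=> //= x ox; case: eqP => // _.
by case: eqP ox => [->//|_ /sm].
Qed.

Lemma inv_start S : inv S -> inv (start_phase S).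
Proof.
move=> [r0 a0 sm]; have [_ TM _] := M_large; split=> //= x ox.
case: eqP => [_|_]; first by rewrite r0; rewrite /T in TM; lia.
by case: eqP ox => [->//|_]; case: eqP => [->//|_ /sm].
Qed.

Lemma hosts_set_scratch S m x v :
  hosts S m -> ~~ odd x -> hosts (set_reg S x v) m.
Proof.
move=> [hr ha] ev; split=> [y|a i] /=; last exact: ha.
by rewrite eq_sym even_neq_odd_name // hr.
Qed.

Lemma wf_codes :
  [/\ wf own_regs tail_expr, wf own_regs head_expr, wf own_regs weight_expr,
      wf own_regs cell_expr & forall K, [/\ wf own_regs (position_expr K),
      wf own_regs (level_expr K) & wf own_regs (arg_expr K)]].
Proof. by split=> //; case. Qed.

(** A sum over the expressions in use, so that each degree lies below it by linear arithmetic. *)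
Definition program_degree : nat :=
  edeg 10 tail_expr + edeg 10 head_expr + edeg 10 weight_expr +
  edeg 10 cell_expr + edeg 10 elapsed_expr +
  (edeg 10 (EOp Sub (EReg 2) (EConst 1)) + edeg 10 (EOp Add slot_reg (EConst 1))
   + edeg 10 slot_reg + edeg 10 (scaled_expr 12) + edeg 10 (scaled_expr 11)
   + edeg 10 found_expr).

Hypothesis B_large : (n + 2) ^ program_degree <= B.

Lemma degree_le d : d <= program_degree -> (n + 2) ^ d <= B.
Proof. by move=> le; apply: leq_trans B_large; rewrite leq_exp2l //; lia. Qed.

Ltac degree :=
  apply: degree_le;
  rewrite ?/position_expr ?/level_expr ?/arg_expr /program_degree; lia.

Lemma B_ge_M : M <= B.
Proof. by apply: degree_le; rewrite /program_degree [edeg 10 slot_reg]/=; lia. Qed.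

Lemma matrix_word_update (N : nat) (G : wdigraph N) (q : update N) i :
  matrix_word (apply_update G q) i =
  if i == q.1.1 * N + q.1.2 then q.2 else matrix_word G i.
Proof.
rewrite /matrix_word /apply_update.
have N0 : 0 < N by apply: leq_ltn_trans (ltn_ord q.1.1).
case: insubP => [u _ uE|ge].
  case: insubP => [v _ vE|]; last by rewrite ltn_mod N0.
  have -> : (i == q.1.1 * N + q.1.2) = (u == q.1.1) && (v == q.1.2).
    rewrite (divn_eq i N) -uE -vE -!(inj_eq val_inj).
    apply/eqP/andP => [E|[/eqP Eu /eqP Ev]]; last first.
      by rewrite (val_inj Eu) (val_inj Ev).
    have [Eu Ev] := divmod2 (val u) (ltn_ord v).
    rewrite E !divmod2 ?ltn_ord // in Eu Ev.
    by split; apply/eqP/esym; [exact: Eu|exact: Ev].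
  by [].
case: eqP => // E; case/negP: ge; rewrite E divmod2 ?ltn_ord //.
Qed.

(** With [k] rounds left, the library's matrix is that of the first [T - k] slots in the decremental
    setting; in the incremental one the body does nothing and the matrix stays zero. *)
Lemma runs_fill K (s0 : 'I_(12 * n)) k S :
  k <= T -> inv S -> reg S 2 = k ->
  hosts S (Store zero_regs (matrix_array
    (graph_at e (if K is Incremental then 0 else T - k)))) ->
  runs B (countdown (fill_step K)) S 0 (fun S' => inv S' /\
    reg S' 4 = reg S 4 /\
    hosts S' (Store zero_regs (matrix_array
      (graph_at e (if K is Incremental then 0 else T))))).
Proof.
have [M11 TM NM] := M_large; have BM := B_ge_M.
elim: k S => [|k IH] S kT iS kE hS.
  by apply: runs_countdown0 => //; rewrite subn0 in hS.
have nw : ~~ writes 2 (fill_step K) by case: (K) => //; vm_compute.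
apply: (@runs_countdownS B _ S k 0 0 (fun S1 => inv S1 /\ reg S1 4 = reg S 4 /\
  hosts S1 (Store zero_regs (matrix_array
    (graph_at e (if K is Incremental then 0 else T - k)))))) => //; try lia.
- case: K IH hS nw => IH hS nw.
    by exists 0, S; split=> //; apply: ExSkip.
  have [r0 a0 sm] := iS; set p := T - k.+1 in hS.
  have pT : p < T by rewrite /p; lia.
  have [wt wh ww wc _] := wf_codes.
  have evp : eval S elapsed_expr = p by rewrite /= r0 kE.
  apply: runs_seq0; first apply: runs_assign_inv => //.
  + by degree.
  + by rewrite evp; lia.
  rewrite evp => S1 [[a1 r1] i1].
  have h1 := hosts_agree_even hS (isT : ~~ odd 6) (conj a1 r1).
  have q1 : reg S1 6 = p by rewrite r1.
  have [r01 a01 sm1] := i1.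
  have /andP[lt1 lt2] := tail_head_lt pT.
  (* Evaluating an expression instance of a code computes to its numerical instance, so only
     register contents have to be rewritten. *)
  have evc : eval S1 cell_expr =
      at_nat tail_code n p * (12 * n) + at_nat head_code n p.
    by rewrite -q1 -r01.
  apply: runs_seq0; first apply: runs_assign_inv => //.
  + by degree.
  + rewrite evc => _; apply: leq_trans NM.
    by have := leq_mul (ltn_trans lt1 lt2) (leqnn (12 * n)); lia.
  rewrite evc => S2 [[a2 r2] i2].
  have h2 := hosts_agree_even h1 (isT : ~~ odd 8) (conj a2 r2).
  have q2 : reg S2 6 = p by rewrite r2.
  have [r02 a02 sm2] := i2.
  have evw : eval S2 weight_expr = weight_at n (adjacency e) p.
    by rewrite /weight_at -a02 -q2 -r02.
  apply: runs_seq0; first apply: runs_assign_inv => //.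
  + by degree.
  + by rewrite evw => _; have := weight_at_le (adjacency e) pT; lia.
  rewrite evw => S3 [[a3 r3] i3].
  have h3 := hosts_agree_even h2 (isT : ~~ odd 10) (conj a3 r3).
  exists 1; eexists; split; first exact: ExStore.
  split; first by have [? ? ?] := i3; split.
  split; first by rewrite /= r3 // /= r2 //= r1.
  have hE := hosts_set_arr 0 (reg S3 8) (reg S3 10) h3.
  apply: hosts_ext hE _ _ => // a i /=; rewrite /matrix_array.
  case: eqP => //= a_0.
  have kT' : k < 11 * (n * n) by rewrite -/T; lia.
  pose q : update (12 * n) := (insubd s0 (at_nat tail_code n p),
    insubd s0 (at_nat head_code n p), weight_at n (adjacency e) p).
  have -> : graph_at e (T - k) = apply_update (graph_at e p) q.
    (* Writing one matrix cell is an insertion, so the incremental update describes the filling of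
       the decremental start graph. *)
    have := @apply_slot_update Incremental n e s0 k kT'.
    by rewrite /graph_of /level /slot_update /position -/T -/p => <-.
  rewrite matrix_word_update /q /= !val_insubd lt2 (ltn_trans lt1 lt2).
  by rewrite r3 // r3 //= r2.
- move=> S1 [i1 [f1 h1]]; apply: runs_weaken (IH _ _ _ _ _) _ => //; first lia.
  + by apply: inv_set_counter => //; lia.
  + by do 2!apply: hosts_set_scratch => //.
  + by move=> S' [i' [f' h']]; split=> //; split=> //; rewrite f' /= f1.
Qed.

Lemma runs_main_step K A k S m own1 lib1 m1 own2 lib2 m2 :
  let p := position K n k in
  k < T -> inv S -> reg S 2 = k.+1 -> hosts S m ->
  exec B (do_update A)
    (set_args m (at_nat tail_code n p) (at_nat head_code n p)
       (if K is Incremental then weight_at n (adjacency e) p else 0))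
    own1 lib1 m1 ->
  exec B (do_query A) m1 own2 lib2 m2 ->
  runs B (main_step K A) S (own1 + lib1 + (own2 + lib2)) (fun S' =>
    [/\ inv S', hosts S' m2
      & reg S' 4 = (0 < reg S 4 + (level K n k < reg m2 0))]).
Proof.
move=> p kT iS kE hS ex1 ex2.
have [M11 TM NM] := M_large; have BM := B_ge_M.
have pT : p < T := position_lt K kT.
have [wt wh _ _ /(_ K) [wp wl wa]] := wf_codes.
have /andP[lt1 lt2] := tail_head_lt pT.
have n12 : 12 * n < M by apply: leq_ltn_trans NM; nia.
have tM : at_nat tail_code n p < M by lia.
have hM : at_nat head_code n p < M by lia.
have vM : weight_at n (adjacency e) p < M by have := weight_at_le (adjacency e) pT; lia.
have [r0 a0 sm] := iS.
have ev1 : eval S (position_expr K) = p.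
  by rewrite /p /position; case: (K); rewrite /= ?r0 kE // subn1.
apply: (runs_seq0 (runs_assign_inv _ wp _ _ _)) => //.
- by case: (K); degree.
- by rewrite ev1; lia.
rewrite ev1 => S1 [ag1 i1].
have h1 := hosts_agree_even hS (isT : ~~ odd 6) ag1.
have q1 : reg S1 6 = p by rewrite (proj2 ag1).
have f1 : reg S1 4 = reg S 4 by rewrite (proj2 ag1).
have ev2 : eval S1 (level_expr K) = level K n k.
  by move: kT q1; rewrite /p /level /position; case: (K) => /= kT ->; lia.
apply: (runs_seq0 (runs_assign_inv _ wl _ _ _)) => //.
- by case: (K); degree.
- by rewrite ev2 => _; rewrite /level -/T; case: (K); lia.
rewrite ev2 => S2 [ag2 i2].
have h2 := hosts_agree_even h1 (isT : ~~ odd 8) ag2.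
have q2 : reg S2 6 = p by rewrite (proj2 ag2).
have l2 : reg S2 8 = level K n k by rewrite (proj2 ag2).
have f2 : reg S2 4 = reg S 4 by rewrite (proj2 ag2).
have ev3 : eval S2 tail_expr = at_nat tail_code n p.
  by have [r02 _ _] := i2; rewrite -q2 -r02.
apply: (runs_seq0 (runs_assign_inv _ wt _ _ _)) => //; first by degree.
rewrite ev3 => S3 [ag3 i3].
have h3 := hosts_agree_odd (y := 0) h2 ag3.
have q3 : reg S3 6 = p by rewrite (proj2 ag3).
have l3 : reg S3 8 = level K n k by rewrite (proj2 ag3).
have f3 : reg S3 4 = reg S 4 by rewrite (proj2 ag3).
have ev4 : eval S3 head_expr = at_nat head_code n p.
  by have [r03 _ _] := i3; rewrite -q3 -r03.
apply: (runs_seq0 (runs_assign_inv _ wh _ _ _)) => //; first by degree.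
rewrite ev4 => S4 [ag4 i4].
have h4 := hosts_agree_odd (y := 1) h3 ag4.
have q4 : reg S4 6 = p by rewrite (proj2 ag4).
have l4 : reg S4 8 = level K n k by rewrite (proj2 ag4).
have f4 : reg S4 4 = reg S 4 by rewrite (proj2 ag4).
have ev5 : eval S4 (arg_expr K) =
    if K is Incremental then weight_at n (adjacency e) p else 0.
  have [r04 a04 _] := i4; case: (K) => //=.
  by rewrite /weight_at -a04 -q4 -r04.
apply: (runs_seq0 (runs_assign_inv _ wa _ _ _)) => //.
- by case: (K); first degree; rewrite [edeg _ _]/=; apply: leq_trans BM; rewrite leq_exp2l //; lia.
rewrite ev5 => S5 [ag5 i5].
have h5 := hosts_agree_odd (y := 2) h4 ag5.
have l5 : reg S5 8 = level K n k by rewrite (proj2 ag5).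
have f5 : reg S5 4 = reg S 4 by rewrite (proj2 ag5).
apply: runs_seq (runs_call ex1 h5) _ => S6 [h6 e6].
rewrite -[own2 + lib2]addn0.
apply: runs_seq (runs_call ex2 h6) _ => S7 [h7 e7].
have i7 := inv_same_even (inv_same_even i5 e6) e7.
have l7 : reg S7 8 = level K n k by rewrite (proj1 e7) // (proj1 e6).
have f7 : reg S7 4 = reg S 4 by rewrite (proj1 e7) // (proj1 e6).
have b7 : reg S7 1 = reg m2 0 := proj1 h7 0.
set found := level K n k < reg m2 0.
apply: (runs_seq0 (R := eq (set_reg S7 10 found))).
  exists 1; eexists; split; last by [].
  by apply: exec_op; rewrite /= ?l7 ?b7 //; case: found; lia.
move=> S8 <-; have [r07 a07 sm7] := i7.
have i8 : inv (set_reg S7 10 found).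
  split=> //= x ox; case: eqP => _; last exact: sm7.
  by case: found; lia.
have h8 : hosts (set_reg S7 10 found) m2 by apply: hosts_set_scratch.
have wf : wf own_regs found_expr by [].
apply: runs_weaken (runs_assign_inv i8 wf _ _ _) _ => //.
- by degree.
- by move=> _ /=; case: ltnP; lia.
move=> S9 [ag9 i9]; split=> //.
  exact: hosts_agree_even h8 (isT : ~~ odd 4) ag9.
by rewrite (proj2 ag9) //= f7.
Qed.

(** Induction on the counter: the flag is monotone, is raised only by a round that beats its level,
    and is raised by every such round. The last clause asks that all bottleneck values exceed the
    level, so it applies to whichever value the algorithm returned. *)
Lemma runs_main K A (s t : 'I_(12 * n)) B' k S m Ttot :
  B' <= B -> k <= T -> inv S -> reg S 2 = k -> hosts S m ->
  serves B' A s t (graph_of K e k) m (slot_updates K e s k) Ttot ->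
  runs B (countdown (main_step K A)) S Ttot (fun S' =>
    [/\ inv S', reg S 4 != 0 -> reg S' 4 != 0,
        reg S' 4 != 0 -> reg S 4 != 0 \/ exists j b,
          [/\ j < k, is_bottleneck (graph_of K e j) s t b & level K n j < b]
      & forall j, j < k ->
          (forall b, is_bottleneck (graph_of K e j) s t b -> level K n j < b) ->
          reg S' 4 != 0]).
Proof.
have [M11 TM NM] := M_large; have BM := B_ge_M.
have nw : ~~ writes 2 (main_step K A).
  rewrite /main_step ![writes _ (CSeq _ _)]/= !writes_rename //.
  by case: (K); vm_compute.
move=> BB; elim: k S m Ttot => [|k IH] S m Ttot kT iS kE hS sv.
  inversion sv; subst; apply: runs_countdown0 => //; split=> // nz; by left.
inversion sv as [|G m' q us m1 m2 own1 lib1 own2 lib2 T' x1 x2 bn sv'].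
subst; rewrite apply_slot_update // in bn sv'.
have kT' : k < 11 * (n * n) by [].
have [pt ph] := (val_tail K e s kT', val_head K e s kT').
have y1 := exec_mono BB x1; have y2 := exec_mono BB x2.
have step := @runs_main_step K A k S m own1 lib1 m1 own2 lib2 m2 kT iS kE hS.
rewrite -pt -ph in step.
apply: (runs_countdownS _ _ nw kE (step y1 y2)); try lia.
move=> S1 [i1 h1 f1].
have i2 : inv (set_reg (set_reg S1 20 1) 2 k) by apply: inv_set_counter => //; lia.
have h2 : hosts (set_reg (set_reg S1 20 1) 2 k) m2.
  by do 2!apply: hosts_set_scratch => //.
have := IH _ _ _ (ltnW kT) i2 erefl h2 sv'.
move/runs_weaken; apply => S' [i' mono sound complete].
rewrite /= in mono sound; rewrite f1 in mono sound; split=> //.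
- by move=> nz; apply: mono; rewrite -lt0n in nz; rewrite addn_gt0 nz.
- move=> /sound[|[j [b [jk bj lb]]]]; last first.
    by right; exists j, b; split=> //; apply: ltnW.
  case: (ltnP (level K n k) (reg m2 0)) => [lt _|_].
    by right; exists k, (reg m2 0).
  by rewrite addn0 => nz; left; rewrite -lt0n; case: ltnP nz.
- move=> j; rewrite ltnS leq_eqVlt => /orP[/eqP->|jk] all_b; last exact: complete all_b.
  by apply: mono; rewrite (all_b _ bn) addn1.
Qed.

End Run.

Lemma clique_program_correct K A n (e : rel 'I_n) B B' (s t : 'I_(12 * n))
    own lib m Ttot :
  0 < n -> symmetric e -> irreflexive e ->
  val s = 0 -> val t = 11 * n ->
  (n + 2) ^ program_degree <= B -> B' <= B ->
  let G := graph_of K e (11 * (n * n)) in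
  exec B' (do_init A) (dyn_input G s t) own lib m ->
  serves B' A s t G m (slot_updates K e s (11 * (n * n))) Ttot ->
  runs B (clique_program K A) (clique_input e) (own + lib + Ttot)
    (fun S => reg S 0 <> 0 <-> has_clique4 e).
Proof.
move=> n0 sy ir s0 t11 BL BB G exi sv.
have [M11 TM NM] := M_large n0; have BM := B_ge_M n0 BL.
have nM : n < (n + 2) ^ 10 by nia.
have i0 : inv e (clique_input e).
  split=> // x _ /=; case: eqP => // _; exact: leq_ltn_trans nM.
(* The zero-initialised odd half is the matrix of the edgeless graph. *)
have hs0 : hosts (start_phase (clique_input e))
    (Store zero_regs (matrix_array (graph_at e 0))).
  do 4!apply: hosts_set_scratch => //; split=> // a i /=.
  rewrite /matrix_array /=; case: eqP => // _.
  rewrite /matrix_word; case: (insub (i %/ (12 * n)) : option 'I_(12 * n)) => // u.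
  case: (insub (i %% (12 * n)) : option 'I_(12 * n)) => // v.
  by rewrite /graph_at slot_graph0.
have i1 := inv_start n0 i0.
have degree d : d <= program_degree -> (n + 2) ^ d <= B by exact: (@degree_le n B n0 BL d).
apply: (runs_seq0 (R := fun S' => inv e S' /\ reg S' 4 = 0 /\
    hosts S' (Store zero_regs (matrix_array G)))).
  apply: runs_phase; [by lia|by rewrite /=; lia|].
  have hs : hosts (start_phase (clique_input e)) (Store zero_regs (matrix_array
      (graph_at e (if K is Incremental then 0 else 11 * (n * n) - 11 * (n * n))))).
    by rewrite subnn; case: (K).
  have := runs_fill n0 BL s (leqnn _) i1 erefl hs.
  move/runs_weaken; apply => S' [i' [f' h']]; split=> //; split=> //.
  by rewrite /G /graph_of /level; case: (K) h' => //; rewrite subnn.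
move=> S1 [{}i1 [f1 h1]].
apply: (runs_seq0 (runs_assign_inv (x := 1) (ex := scaled_expr 12) n0 i1 isT _ _ _)) => //.
  by apply: degree; rewrite /program_degree; lia.
move=> S2 [ag2 i2]; have h2 := hosts_agree_odd (y := 0) h1 ag2.
have f2 : reg S2 4 = 0 by rewrite (proj2 ag2).
apply: (runs_seq0 (runs_assign_inv (x := 3) (ex := EConst 0) n0 i2 isT _ _ _)) => //.
  by apply: degree; rewrite /program_degree [edeg 10 slot_reg]/= [edeg _ (EConst 0)]/=; lia.
move=> S3 [ag3 i3]; have h3 := hosts_agree_odd (y := 1) h2 ag3.
have f3 : reg S3 4 = 0 by rewrite (proj2 ag3).
apply: (runs_seq0 (runs_assign_inv (x := 5) (ex := scaled_expr 11) n0 i3 isT _ _ _)) => //.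
  by apply: degree; rewrite /program_degree; lia.
move=> S4 [ag4 i4]; have h4 := hosts_agree_odd (y := 2) h3 ag4.
have f4 : reg S4 4 = 0 by rewrite (proj2 ag4).
have {}h4 : hosts S4 (dyn_input G s t).
  rewrite /dyn_input /set_args; move: h4.
  have [r1 _ _] := i1; have [r3 _ _] := i3.
  by rewrite /= r1 r3 -[nat_of_ord s]/(val s) -[nat_of_ord t]/(val t) s0 t11.
apply: runs_seq (runs_call (exec_mono BB exi) h4) _ => S5 [h5 e5].
have i5 := inv_same_even i4 e5.
have f5 : reg S5 4 = 0 by rewrite (proj1 e5).
have [r5 a5 sm5] := i5.
rewrite -[Ttot]addn0.
apply: (@runs_seq _ _ _ _ _ _ (fun S' => inv e S' /\
    (reg S' 4 <> 0 <-> has_clique4 e))); last first.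
  move=> S6 [[r6 a6 sm6] iff6].
  have Mn : 1 < n + 2 by lia.
  have small y : own_regs y -> y < 20 by rewrite /own_regs /= !inE; lia.
  have as_ i : arr S6 0 i < (n + 2) ^ 10 by rewrite a6 adjacency_small.
  have wf4 : wf own_regs (EReg 4) by [].
  have dB : (n + 2) ^ edeg 10 (EReg 4) <= B by [].
  apply: runs_weaken (runs_assign 0 Mn small sm6 as_ wf4 dB) _ => S' [_ rE].
  by rewrite rE.
apply: runs_phase; [by lia|by rewrite r5; lia|].
have h5' : hosts (start_phase S5) m by do 3!apply: hosts_set_scratch => //.
have k5 : reg (start_phase S5) 2 = 11 * (n * n) by rewrite /= r5.
have := runs_main n0 BL BB (leqnn _) (inv_start n0 i5) k5 h5' sv.
move/runs_weaken; apply => S6 [i6 _ sound complete]; split=> //; split.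
  move/eqP/sound => [|[j [b [jT bj lt]]]]; first by rewrite /= f5.
  exact: (graph_sound sy ir s0 t11 bj lt).
case/(graph_complete sy ir s0 t11)=> j [j0 jT all_b]; apply/eqP.
(* The counter value at which exactly [j] slots are present. *)
have lj : level K n (if K is Incremental then 11 * (n * n) - j else j) = j.
  by rewrite /level; case: (K); lia.
apply: (complete (if K is Incremental then 11 * (n * n) - j else j)).
  by case: (K); lia.
by rewrite /graph_of lj.
Qed.

(** * Time bounds with real exponents, and the lower bound *)

Section Time.
Local Open Scope R_scope.

(** The quadratic own time fits once the exponent is at least 2, hence the cap of [eps] at 2.
    Passing from [12 * n] vertices to [n] costs a factor 12^p. *)
Lemma time_bound_combine (eps : R) (D : R) (C : nat) :
  (0 < eps)%coqR ->
  exists D' : R, forall n own t : nat, (0 < n)%N ->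
    (own <= C * (n ^ 2 + 1))%N ->
    time_bound D (4 - eps)%coqR (12 * n) t ->
    time_bound D' (4 - Rmin eps 2)%coqR n (own + t).
Proof.
move=> eps0; pose p := (4 - Rmin eps 2)%coqR.
have p2 : (2 <= p)%coqR by rewrite /p; have := Rmin_r eps 2; lra.
have pe : (4 - eps <= p)%coqR by rewrite /p; have := Rmin_l eps 2; lra.
exists (INR C * 2 + Rabs D * Rpower 12 p)%coqR => n own t n0 le_own tb.
rewrite /time_bound -/p plus_INR Rmult_plus_distr_r.
have n1 : (1 <= INR n)%coqR by apply: (le_INR 1); lia.
have X0 : (0 < Rpower (INR n) p)%coqR by apply: exp_pos.
have X2 : (INR n * INR n <= Rpower (INR n) p)%coqR.
  have <- : (Rpower (INR n) 2 = INR n * INR n)%coqR.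
    by rewrite (_ : 2 = 1 + 1)%coqR ?Rpower_plus ?Rpower_1; lra.
  by apply: Rle_Rpower.
apply: Rplus_le_compat.
  apply: (Rle_trans _ (INR (C * (n * n + n * n)))).
    apply/le_INR/leP; apply: leq_trans le_own _.
    by rewrite leq_mul2l -mulnn leq_add2l muln_gt0 n0 orbT.
  rewrite mult_INR plus_INR mult_INR Rmult_assoc.
  apply: Rmult_le_compat_l; first exact: pos_INR.
  lra.
apply: Rle_trans tb _.
have n12 : (INR (12 * n) = 12 * INR n)%coqR by rewrite mult_INR /=; lra.
rewrite Rmult_assoc (Rpower_mult_distr 12 (INR n) p); try lra.
(* [D] may be negative, so its absolute value is taken before the power is enlarged. *)
apply: (Rle_trans _ (Rabs D * Rpower (INR (12 * n)) (4 - eps))).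
  apply: Rmult_le_compat_r; first exact/Rlt_le/exp_pos.
  exact: Rle_abs.
apply: Rmult_le_compat_l; first exact: Rabs_pos.
by rewrite n12; apply: Rle_Rpower => //; lra.
Qed.

End Time.

Lemma stBP_lower_bound (C : algorithm_class) (K : setting) :
  closed_under_linear_reductions C -> clique4_hypothesis C ->
  stBP_requires_n4 C K.
Proof.
(* The weights are bounded by the square of the number [12 * n] of vertices, whence the exponent
   2. *)
move=> Hclosed Hclique eps eps0 [A [dA]] /(_ 2%N) [c [D solves]].
have lin := program_linear K A; have [N linN] := lin.
have [D' timeE] := @time_bound_combine eps D N eps0.
have min0 : (0 < Rmin eps 2)%coqR by apply: Rmin_glb_lt => //; lra.
apply: (Hclique _ min0); exists (clique_program K A); split.
  exact: Hclosed dA (program_library K A) lin.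
(* One summand serves the program's own words, the other the library's: 12 n + 2 <= 27 (n + 2) <= (n
   + 2)^4, as n + 2 >= 3. *)
exists (program_degree + 4 * c)%N, D' => n e n0 sy ir.
have n12 : (0 < 12 * n)%N by lia.
have n11 : (11 * n < 12 * n)%N by lia.
pose s := Ordinal n12; pose t := Ordinal n11.
have st : s != t by apply/eqP => /(congr1 val) /=; lia.
have [own [lib [m [T [exi sv tb]]]]] := solves _ s t _ _ st
  (slot_start_valid K e n0) (slot_updates_valid K e s (leqnn _)).
pose B := word_bound n (program_degree + 4 * c).
have B1 : ((n + 2) ^ program_degree <= B)%N.
  by rewrite leq_exp2l ?leq_addr //; lia.
have B2 : (word_bound (12 * n) c <= B)%N.
  apply: (@leq_trans ((n + 2) ^ (4 * c))%N); last first.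
    by rewrite leq_exp2l ?leq_addl //; lia.
  rewrite /word_bound expnM; case: (c) => // c'; rewrite leq_exp2r //.
  have : (3 ^ 3 <= (n + 2) ^ 3)%N by rewrite leq_exp2r //; lia.
  by rewrite (expnS _ 3) (_ : (3 ^ 3 = 27)%N) //; nia.
have [own' [S [ex iff]]] :=
  clique_program_correct n0 sy ir (erefl : val s = 0%N) (erefl : val t = (11 * n)%N) B1 B2 exi sv.
exists own', (own + lib + T)%N, S; split=> //.
exact: timeE n0 (linN _ _ _ _ _ _ ex) tb.
Qed.

Theorem theorem4p12 (combinatorial : algorithm_class)
    (Hclosed : closed_under_linear_reductions combinatorial)
    (Hclique : clique4_hypothesis combinatorial) :
  stBP_requires_n4 combinatorial Incremental /\
  stBP_requires_n4 combinatorial Decremental.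
Proof. by split; apply: stBP_lower_bound. Qed.
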